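(* Let $R$ be the endomorphism ring of an elliptic curve, let $H$ be a finite subgroup of $GL(2,R)$ with $$H\cap SL(2,R)=\langle g_1,g_2\mid g_1^2=g_2^2=-I_2,\ g_2g_1=-g_1g_2\rangle\simeq\mathbb{Q}_8,$$ and let $h_o\in H$ be an element of order $r$ with $\det(H)=\langle\det(h_o)\rangle\simeq C_s$, $s>1$, and eigenvalues $\lambda_1(h_o),\lambda_2(h_o)$. Then $H$ is isomorphic to some $H_{Q8}(i)$, $1\leq i\leq9$, where $H_{Q8}(1)=\langle g_1,g_2,iI_2\mid g_1^2=g_2^2=-I_2,\ g_2g_1=-g_1g_2\rangle$ is of order $16$ with $R=\mathbb{Z}[i]$; $H_{Q8}(2)=\langle g_1,g_2,h_o\mid g_1^2=g_2^2=-I_2,\ h_o^2=I_2,\ g_2g_1=-g_1g_2,\ h_og_1h_o^{-1}=-g_1,\ h_og_2h_o^{-1}=-g_2\rangle$ is of order $16$ with $R=\mathbb{Z}[i]$, $\lambda_1(h_o)=-1$, $\lambda_2(h_o)=1$; $H_{Q8}(3)=\langle g_1,g_2,h_o\mid g_1^2=g_2^2=h_o^4=-I_2,\ g_2g_1=-g_1g_2,\ h_og_1h_o^{-1}=g_2,\ h_og_2h_o^{-1}=-g_1\rangle$ is of order $16$ with $R=\mathcal{O}_{-2}$, $\lambda_1(h_o)=e^{\frac{\pi i}{4}}$, $\lambda_2(h_o)=e^{\frac{3\pi i}{4}}$, $h_o^2=\pm g_1g_2$; $H_{Q8}(4)=\langle g_1,g_2,h_o\mid g_1^2=g_2^2=-I_2,\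 h_o^2=I_2,\ g_2g_1=-g_1g_2,\ h_og_1h_o^{-1}=g_2,\ h_og_2h_o^{-1}=g_1\rangle$ is of order $16$ with $R=R_{-2,f}$, $\lambda_1(h_o)=-1$, $\lambda_2(h_o)=1$; $H_{Q8}(5)=\langle g_1,g_2\rangle\times\langle e^{\frac{2\pi i}{3}}I_2\rangle\simeq\mathbb{Q}_8\times C_3$ is of order $24$ with $R=\mathcal{O}_{-3}$; $H_{Q8}(6)=\langle g_1,g_2,h_o\mid g_1^2=g_2^2=-I_2,\ h_o^3=I_2,\ g_2g_1=-g_1g_2,\ h_og_1h_o^{-1}=g_2,\ h_og_2h_o^{-1}=g_1g_2\rangle$ is of order $24$ with $R=\mathcal{O}_{-3}$, $\lambda_1(h_o)=e^{\frac{2\pi i}{3}}$, $\lambda_2(h_o)=1$; $H_{Q8}(7)=\langle g_1,g_2,h_o\mid g_1^2=g_2^2=h_o^4=-I_2,\ g_2g_1=-g_1g_2,\ h_og_1h_o^{-1}=-g_1,\ h_og_2h_o^{-1}=-g_2\rangle$ is of order $32$ with $R=\mathbb{Z}[i]$, $\lambda_1(h_o)=e^{\frac{3\pi i}{4}}$, $\lambda_2(h_o)=e^{-\frac{\pi i}{4}}$; $H_{Q8}(8)=\langle g_1,g_2,h_o\mid g_1^2=g_2^2=h_o^4=-I_2,\ g_2g_1=-g_1g_2,\ h_og_1h_o^{-1}=g_2,\ h_og_2h_o^{-1}=g_1\rangle$ is of order $32$ with $R=\mathbb{Z}[i]$, $\lambda_1(h_o)=e^{\frac{3\pi i}{4}}$,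 $\lambda_2(h_o)=e^{-\frac{\pi i}{4}}$; $H_{Q8}(9)=\langle g_1,g_2,h_o\mid g_1^2=g_2^2=-I_2,\ h_o^4=I_2,\ g_2g_1=-g_1g_2,\ h_og_1h_o^{-1}=g_2,\ h_og_2h_o^{-1}=-g_1\rangle$ is of order $32$ with $R=\mathbb{Z}[i]$, $\lambda_1(h_o)=i$, $\lambda_2(h_o)=1$. There exist subgroups $H_{Q8}(1),H_{Q8}(2),H_{Q8}(9)<GL(2,\mathbb{Z}[i])$, $H_{Q8}(5)<GL(2,\mathcal{O}_{-3})$, as well as subgroups $H^o_{Q8}(4)<GL(2,\mathbb{Q}(\sqrt{-2}))$, $H^o_{Q8}(6)<GL(2,\mathbb{Q}(\sqrt{-3}))$, $H^o_{Q8}(3),H^o_{Q8}(7),H^o_{Q8}(8)<GL(2,\mathbb{Q}(\sqrt2,i))$ such that $H^o_{Q8}(j)\simeq H_{Q8}(j)$ for $j\in\{3,4,6,7,8\}$.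
   Context: $R=\mathrm{End}(E)$ for a complex elliptic curve $E$; thus $R=\mathbb{Z}$ or $R=R_{-d,f}=\mathbb{Z}+f\mathcal{O}_{-d}\subset\mathbb{C}$ with a conductor $f\in\mathbb{N}$ and $\mathcal{O}_{-d}$ the integers ring of an imaginary quadratic field $\mathbb{Q}(\sqrt{-d})$. $GL(2,R)=\{g\in R_{2\times2}:\det(g)\in R^*\}$, $SL(2,R)$ is its subgroup of matrices of determinant $1$, $C_n$ is the cyclic group of order $n$ and $\mathbb{Q}_8$ is the quaternion group of order $8$. Each listed $H_{Q8}(i)$ is a matrix group of the indicated order, generated by matrices $g_1,g_2\in SL(2,R)$ and $h_o\in GL(2,R)$ (or the displayed scalar matrix) which satisfy the displayed relations and have the indicated eigenvalues, with $H_{Q8}(i)\cap SL(2,R)=\langle g_1,g_2\rangle\simeq\mathbb{Q}_8$; ''with $R=\dots$'' means that the case is listed only for that ring. *)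

(* Defs.v *)
From HB Require Import structures.
From mathcomp Require Import all_boot all_order all_algebra.
From mathcomp Require Import all_fingroup all_solvable.
From mathcomp Require Import all_classical all_reals all_analysis.
From mathcomp Require Import complex.

Set Implicit Arguments.
Unset Strict Implicit.
Unset Printing Implicit Defensive.

Import Order.TTheory GRing.Theory Num.Theory.

Local Open Scope classical_set_scope.
Local Open Scope card_scope.
Local Open Scope complex_scope.
Local Open Scope ring_scope.

Definition mul_iso (T U : Type) (mulT : T -> T -> T) (mulU : U -> U -> U)
    (A : set T) (B : set U) : Prop :=
  exists f : T -> U, set_bij A B f /\
    forall x y, A x -> A y -> f (mulT x y) = mulU (f x) (f y).

Section Defs.
Variable R : realType.
Local Notation C := R[i].
Local Notation M2 := 'M[R[i]]_2.

Definition expi (t : R) : C := cos t +i* sin t.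

(* The curve C/L with L = Z w1 + Z w2 has as endomorphisms the multiplications
   by the complex numbers a with a L `<=` L; this identifies its endomorphism
   ring with a subring of C. *)
Definition period_lattice (w1 w2 : C) : set C :=
  [set x | exists m n : int, x = m%:~R * w1 + n%:~R * w2].

Definition endomorphism_ring (L : set C) : set C :=
  [set a | forall x, L x -> L (a * x)].

Definition is_elliptic_endomorphism_ring (S : set C) : Prop :=
  exists w1 w2 : C,
    (forall a b : R, a%:C * w1 + b%:C * w2 = 0 -> a = 0 /\ b = 0) /\
    S = endomorphism_ring (period_lattice w1 w2).

Definition generated_field (A : set C) : set C :=
  \bigcap_(F in [set F : set C | GRing.divring_closed [in F] /\ A `<=` F]) F.

Definition quadratic_field (d : nat) : set C :=
  generated_field [set 0 +i* Num.sqrt d%:R].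

Definition quadratic_integers (d : nat) : set C :=
  quadratic_field d `&` [set x : C | integralOver (intr : int -> C) x].

Definition quadratic_order (d f : nat) : set C :=
  [set x | exists (m : int) (y : C),
     quadratic_integers d y /\ x = m%:~R + f%:R * y].

Definition gaussian_integers : set C :=
  [set x | exists a b : int, x = a%:~R + b%:~R * 'i%C].

Definition units (S : set C) : set C :=
  [set u | S u /\ exists v, S v /\ u * v = 1].

Definition GL2 (S : set C) : set M2 :=
  [set g : M2 | (forall i j : 'I_2, S (g i j)) /\ units S (\det g)].

Definition SL2 (S : set C) : set M2 :=
  [set g : M2 | GL2 S g /\ \det g = 1].

Definition mx_subgroup (G K : set M2) : Prop :=
  [/\ K `<=` G, K 1,
      forall x y, K x -> K y -> K (x * y) &
      forall x, K x -> K x^-1].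

Definition mx_generated (A : set M2) : set M2 :=
  \bigcap_(K in [set K : set M2 | mx_subgroup (GL2 [set: C]) K /\ A `<=` K]) K.

(* Eigenvalues counted with multiplicity. *)
Definition eigenvalues (h : M2) (a b : C) : Prop :=
  char_poly h = ('X - a%:P) * ('X - b%:P).

Definition Q8_generators (g1 g2 : M2) : Prop :=
  [/\ g1 ^+ 2 = -1, g2 ^+ 2 = -1, g2 * g1 = - (g1 * g2) &
      mul_iso *%R (fun x y : 'Q_8 => (x * y)%g)
        (mx_generated [set g1; g2]) [set: 'Q_8]].

(* Isomorphism type Q8 x C3; the finite group 'Z_3 is written additively. *)
Definition iso_Q8_C3 (K : set M2) : Prop :=
  mul_iso *%R
    (fun x y : 'Q_8 * 'Z_3 => ((x.1 * y.1)%g, x.2 + y.2)) K setT.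

Definition internal_direct_product (K A B : set M2) : Prop :=
  [/\ K = [set x | exists a b, [/\ A a, B b & x = a * b]],
      A `&` B = [set 1] &
      forall a b, A a -> B b -> a * b = b * a].

Definition HQ8_order (i : nat) : nat :=
  match i with
  | 1 | 2 | 3 | 4 => 16
  | 5 | 6 => 24
  | _ => 32
  end.

Definition HQ8_relations (i : nat) (K : set M2) (g1 g2 h : M2) : Prop :=
  match i with
  | 1 => h = ('i%C)%:M
  | 2 => [/\ h ^+ 2 = 1, h * g1 * h^-1 = - g1, h * g2 * h^-1 = - g2 &
             eigenvalues h (-1) 1]
  | 3 => [/\ h ^+ 4 = -1, h * g1 * h^-1 = g2, h * g2 * h^-1 = - g1,
             eigenvalues h (expi (pi / 4)) (expi (3 * pi / 4)) &
             h ^+ 2 = g1 * g2 \/ h ^+ 2 = - (g1 * g2)]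
  | 4 => [/\ h ^+ 2 = 1, h * g1 * h^-1 = g2, h * g2 * h^-1 = g1 &
             eigenvalues h (-1) 1]
  | 5 => [/\ h = (expi (2 * pi / 3))%:M,
             internal_direct_product K
               (mx_generated [set g1; g2]) (mx_generated [set h]) &
             iso_Q8_C3 K]
  | 6 => [/\ h ^+ 3 = 1, h * g1 * h^-1 = g2, h * g2 * h^-1 = g1 * g2 &
             eigenvalues h (expi (2 * pi / 3)) 1]
  | 7 => [/\ h ^+ 4 = -1, h * g1 * h^-1 = - g1, h * g2 * h^-1 = - g2 &
             eigenvalues h (expi (3 * pi / 4)) (expi (- (pi / 4)))]
  | 8 => [/\ h ^+ 4 = -1, h * g1 * h^-1 = g2, h * g2 * h^-1 = g1 &
             eigenvalues h (expi (3 * pi / 4)) (expi (- (pi / 4)))]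
  | 9 => [/\ h ^+ 4 = 1, h * g1 * h^-1 = g2, h * g2 * h^-1 = - g1 &
             eigenvalues h 'i%C 1]
  | _ => False
  end.

(* The groups H_Q8(i), 1 <= i <= 9, as subgroups of GL(2, S). The relations are
   between matrices (-1 is -I_2, not an abstract central generator); the ring
   for which H_Q8(i) is listed is imposed separately by HQ8_ring. *)
Definition is_HQ8 (S : set C) (i : nat) (K : set M2) : Prop :=
  mx_subgroup (GL2 S) K /\ K #= `I_(HQ8_order i) /\
  exists g1 g2 h : M2,
    [/\ SL2 S g1, SL2 S g2 & GL2 S h] /\
    [/\ K = mx_generated [set g1; g2; h],
        K `&` SL2 S = mx_generated [set g1; g2],
        Q8_generators g1 g2 &
        HQ8_relations i K g1 g2 h].

Definition HQ8_ring (i : nat) (S : set C) : Prop :=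
  match i with
  | 1 | 2 | 7 | 8 | 9 => S = gaussian_integers
  | 3 => S = quadratic_integers 2
  | 4 => exists f : nat, (0 < f)%N /\ S = quadratic_order 2 f
  | 5 | 6 => S = quadratic_integers 3
  | _ => False
  end.

(* H_Q8(i) stands for one group up to isomorphism: it must be realizable in
   GL(2, S), and H must be isomorphic to each of its realizations there. *)
Definition isomorphic_to_HQ8 (S : set C) (i : nat) (H : set M2) : Prop :=
  (exists K, is_HQ8 S i K) /\
  (forall K, is_HQ8 S i K -> mul_iso *%R *%R H K).

Definition field_sqrt2_i : set C :=
  generated_field [set (Num.sqrt 2)%:C; 'i%C].

End Defs.

(* Main.v *)
Require Import Defs.
From HB Require Import structures.
From mathcomp Require Import all_boot all_order all_algebra.
From mathcomp Require Import all_fingroup all_solvable.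
From mathcomp Require Import all_classical all_reals all_analysis.
From mathcomp Require Import complex ring lra zify.
Import Order.TTheory GRing.Theory Num.Theory.
Local Open Scope classical_set_scope.
Local Open Scope card_scope.
Local Open Scope complex_scope.
Local Open Scope ring_scope.

Set Implicit Arguments.
Unset Strict Implicit.
Unset Printing Implicit Defensive.

(** Let Q = <g1, g2> be the quaternion group H :&: SL(2, S).  Every pair of
    complex 2 x 2 matrices with the quaternion relations is conjugate to one
    standard pair ([Q8_rel_conj_std]), so 1, g1, g2, g1 g2 is a basis of the
    matrix algebra.  In the resulting coordinates ([quat]) products, traces
    and determinants are those of Hamilton quaternions over C, and only the
    scalars commute with Q ([quat_centre]).

    Uniqueness.  If two invertible matrices act on g1, g2 by the same
    conjugation, their quotient is a scalar; if they also have the same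
    determinant they agree up to sign ([same_action_sign]), and -1 lies in Q.
    Each of the nine presentations prescribes the conjugation action of its
    third generator and, through the eigenvalues, its determinant.  Hence a
    group with presentation n is <g1, g2, HQ8_gen n g1 g2> for an explicit
    third generator ([is_HQ8_normal_form]), and any two of them are conjugate
    in GL(2, C), whatever rings their entries lie in ([is_HQ8_unique]).
    Conversely such a group does realize presentation n as soon as its three
    generators have entries in S ([HQ8_gen_is_HQ8]); all existence claims
    follow by exhibiting generators with entries in the required ring.

    Classification.  An element of H normalizes Q.  Modulo Q and up to the
    choice of the generating pair it either centralizes Q, or rotates
    g1 -> g2 -> -g1, or cycles g1 -> g2 -> g1 g2 ([Q8_normalizer]).  An element
    of S is an eigenvalue of an integral 2 x 2 matrix, so its trace and norm
    are integers ([elliptic_integral_ring]); therefore det ho <> 1 is a root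
    of unity of order 2, 3, 4 or 6 ([units_cases]).
    - Order 2: a centralizing element is a scalar c with c^2 = -1, so i is
      in S and n = 1; a rotating one has a trace with square -2, so sqrt(-2)
      is in S and n = 3; the square of a cycling one has determinant 1 and
      still permutes the axes, which no element of Q does.
    - Order 4: c^2 = i has no solution in S, and the fourth power of a cycling
      element is excluded as before, so n = 9.
    - Order 3: the cube of a rotating element is excluded in the same way; a
      centralizing element gives n = 5 and a cycling one n = 6.
    - Order 6: the cube of ho puts i or sqrt(-2) in S next to a primitive
      sixth root of unity, and a product then has a non-integral trace.
    Finally S is determined by the number found in it: an element x of an
    order containing t has integral traces of x and t x and integral norm,
    and for t = i, sqrt(-2), omega this forces x into Z[t] ([adjoin_eq]).
    Over these rings presentations 2, 4, 8 give the same groups as 1, 3, 9, and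
    presentation 7 would put a primitive eighth root of unity into S. *)

(** * Two-by-two matrices and quaternion coordinates *)

Lemma ord2_cases (P : 'I_2 -> Prop) : P 0 -> P 1 -> forall i, P i.
Proof.
move=> P0 P1 [[|[|i]] // lt_i2].
- by rewrite (_ : Ordinal _ = 0); last exact: val_inj.
- by rewrite (_ : Ordinal _ = 1); last exact: val_inj.
Qed.

Lemma sum_ord2 (V : nmodType) (f : 'I_2 -> V) : \sum_k f k = f 0 + f 1.
Proof.
by rewrite !big_ord_recl big_ord0 addr0; congr (_ + f _); apply: val_inj.
Qed.

Lemma det_mx2 (K : comNzRingType) (x : 'M[K]_2) :
  \det x = x 0 0 * x 1 1 - x 0 1 * x 1 0.
Proof.
rewrite (expand_det_row _ 0) sum_ord2 /cofactor.
rewrite !det_mx11 !mxE /= expr0 expr1 mul1r mulN1r mulrN.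
by congr (_ * x _ _ - x _ _ * x _ _); apply: val_inj.
Qed.

(** The triple (s, b, c) stands for (-1)^s x^b y^c in the quaternion group with
    generators x, y; this single multiplication table parametrizes the matrix
    group <g1, g2> as well as the abstract group. *)
Definition q8_op (t u : bool * bool * bool) : bool * bool * bool :=
  let: (s, b, c) := t in let: (s', b', c') := u in
  (s (+) s' (+) (b && b') (+) (c && b') (+) (c && c'), b (+) b', c (+) c').

Definition q8_inv (t : bool * bool * bool) : bool * bool * bool :=
  let: (s, b, c) := t in (s (+) (b || c), b, c).

Lemma q8_opV t : q8_op t (q8_inv t) = (false, false, false).
Proof. by case: t => -[[] []] []. Qed.

Section QuaternionCoordinates.
Variable F : fieldType.
Local Notation M2 := 'M[F]_2.

Definition mx2 (a b c d : F) : M2 :=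
  \matrix_(i, j) if i == 0 then (if j == 0 then a else b)
                 else (if j == 0 then c else d).

Lemma mx2_eta (x : M2) : x = mx2 (x 0 0) (x 0 1) (x 1 0) (x 1 1).
Proof.
by apply/matrixP; elim/ord2_cases; elim/ord2_cases; rewrite !mxE.
Qed.

Lemma mx2_mul a b c d a' b' c' d' :
  mx2 a b c d * mx2 a' b' c' d' =
  mx2 (a * a' + b * c') (a * b' + b * d') (c * a' + d * c') (c * b' + d * d').
Proof.
by apply/matrixP; elim/ord2_cases; elim/ord2_cases;
  rewrite !mxE sum_ord2 !mxE.
Qed.

Lemma mx2_add a b c d a' b' c' d' :
  mx2 a b c d + mx2 a' b' c' d' = mx2 (a + a') (b + b') (c + c') (d + d').
Proof. by apply/matrixP; elim/ord2_cases; elim/ord2_cases; rewrite !mxE. Qed.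

Lemma mx2_scale k a b c d :
  k *: mx2 a b c d = mx2 (k * a) (k * b) (k * c) (k * d).
Proof. by apply/matrixP; elim/ord2_cases; elim/ord2_cases; rewrite !mxE. Qed.

Lemma mx2_opp a b c d : - mx2 a b c d = mx2 (- a) (- b) (- c) (- d).
Proof. by apply/matrixP; elim/ord2_cases; elim/ord2_cases; rewrite !mxE. Qed.

Lemma mx2_1 : 1 = mx2 1 0 0 1.
Proof. by apply/matrixP; elim/ord2_cases; elim/ord2_cases; rewrite !mxE. Qed.

Lemma trace_mx2 (x : M2) : \tr x = x 0 0 + x 1 1.
Proof.
exact: sum_ord2.
Qed.

Lemma char_poly_mx2 (x : M2) (a b : F) :
  char_poly x = ('X - a%:P) * ('X - b%:P) <->
  a + b = \tr x /\ a * b = \det x.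
Proof.
have -> : char_poly x = 'X^2 - (\tr x)%:P * 'X + (\det x)%:P.
  rewrite /char_poly !det_mx2 trace_mx2 /char_poly_mx !mxE /=.
  rewrite !polyCB !polyCM polyCD; ring.
have -> : ('X - a%:P) * ('X - b%:P) = 'X^2 - (a + b)%:P * 'X + (a * b)%:P.
  by rewrite polyCM polyCD; ring.
split=> [E | [-> ->] //]; split.
- have /(congr1 (fun p : {poly F} => p`_1)) := E.
  by rewrite !coefE /= !mulr1 !addr0 !sub0r => /oppr_inj.
- have /(congr1 (fun p : {poly F} => p`_0)) := E.
  by rewrite !coefE /= ?mulr0 ?subr0 ?add0r ?subrr ?add0r.
Qed.

Definition Q8_rel (g1 g2 : M2) : Prop :=
  [/\ g1 * g1 = -1, g2 * g2 = -1 & g2 * g1 = - (g1 * g2)].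

(** The Hamilton quaternion a + b i + c j + d k with i, j, k replaced by
    g1, g2, g1 g2. *)
Definition quat (g1 g2 : M2) (a b c d : F) : M2 :=
  a *: 1 + b *: g1 + c *: g2 + d *: (g1 * g2).

Definition Q8_elt g1 g2 (t : bool * bool * bool) : M2 :=
  let: (s, b, c) := t in (-1) ^+ s *: (g1 ^+ b * g2 ^+ c).

Variable i : F.
Hypothesis i2 : i * i = -1.
Hypothesis two_neq0 : 2 != 0 :> F.

(** The standard pair, in which g1 is diagonal. *)
Definition std1 : M2 := mx2 i 0 0 (- i).
Definition std2 : M2 := mx2 0 1 (-1) 0.

Lemma Q8_rel_std : Q8_rel std1 std2.
Proof.
by split; rewrite /std1 /std2 !mx2_mul ?mx2_1 !mx2_opp; congr mx2; ring: i2.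
Qed.

Lemma quat_std a b c d :
  quat std1 std2 a b c d = mx2 (a + i * b) (c + i * d) (- c + i * d) (a - i * b).
Proof.
rewrite /quat /std1 /std2 mx2_mul mx2_1 !mx2_scale !mx2_add.
by congr mx2; ring.
Qed.

Lemma i_neq0 : i != 0.
Proof.
by apply: contra_eq_neq i2 => ->; rewrite mul0r eq_sym oppr_eq0 oner_eq0.
Qed.

Lemma opp_neq (x : M2) : x != 0 -> x != - x.
Proof.
move=> x0; rewrite -subr_eq0 opprK; apply: contra x0.
by rewrite -mulr2n -scaler_nat scaler_eq0 (negPf two_neq0).
Qed.

Lemma row_std (P : M2) :
  [/\ row 0 (std1 *m P) = i *: row 0 P, row 1 (std1 *m P) = - i *: row 1 P,
      row 0 (std2 *m P) = row 1 P & row 1 (std2 *m P) = - row 0 P].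
Proof.
split; apply/rowP => k; rewrite !mxE !sum_ord2 !mxE /=;
  by rewrite ?(mul0r, mul1r, mulN1r, add0r, addr0).
Qed.

(** Over the eigenvalue i the row space of g1 contains some v; then v g2 is an
    eigenvector for -i, and in the basis (v, v g2) the pair is standard. *)
Lemma Q8_rel_conj_std g1 g2 : Q8_rel g1 g2 ->
  exists2 P : M2, P \in unitmx & P *m g1 = std1 *m P /\ P *m g2 = std2 *m P.
Proof.
rewrite /Q8_rel -!mulmxE => -[g11 g22 g21].
have g1_neq0 : g1 != 0.
  by apply: contra_eq_neq g11 => ->; rewrite mul0mx eq_sym oppr_eq0 oner_eq0.
(* The rows of e are eigenvectors of g1, because (g1 + i) (g1 - i) = 0. *)
pose e := g1 + i%:M.
have eg1 : e *m g1 = i *: e.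
  rewrite /e mulmxDl g11 mul_scalar_mx scalerDr scale_scalar_mx i2 addrC.
  by rewrite raddfN.
have [k ek0] : exists k, row k e != 0.
  apply/existsP; apply: contraT; rewrite negb_exists => /forallP e0.
  have /eqP : e = 0.
    by apply/row_matrixP => k; apply/eqP; rewrite row0; apply: (negPn (e0 k)).
  rewrite addr_eq0 => /eqP g1i; move: g21.
  rewrite g1i mulmxN mulNmx mul_scalar_mx mul_mx_scalar => /eqP.
  move=> gg; suff : - (i *: g2) != - - (i *: g2) by rewrite gg.
  apply: opp_neq; rewrite oppr_eq0 scaler_eq0 (negPf i_neq0) /=.
  by apply: contra_eq_neq g22 => ->; rewrite mul0mx eq_sym oppr_eq0 oner_eq0.
pose v := row k e; pose w := v *m g2.
have vg1 : v *m g1 = i *: v by rewrite -row_mul eg1 linearZ.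
have wg1 : w *m g1 = - i *: w.
  by rewrite -mulmxA g21 mulmxN mulmxA vg1 -scalemxAl scaleNr.
have wg2 : w *m g2 = - v by rewrite -mulmxA g22 mulmxN mulmx1.
have w_neq0 : w != 0.
  apply: contra ek0 => /eqP w0; rewrite -/v -[v]opprK -wg2 w0 mul0mx oppr0.
  by [].
pose P : M2 := \matrix_a (if a == 0 then v else w).
have rP0 : row 0 P = v by rewrite rowK.
have rP1 : row 1 P = w by rewrite rowK.
exists P; last first.
  have [r10 r11 r20 r21] := row_std P.
  split; apply/row_matrixP; elim/ord2_cases; rewrite row_mul ?rP0 ?rP1.
  - by rewrite vg1 r10 rP0.
  - by rewrite wg1 r11 rP1.
  - by rewrite r20 rP1.
  - by rewrite wg2 r21 rP0.
rewrite -row_free_unit -kermx_eq0; apply/rowV0P => u /sub_kermxP uP0.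
have uP : u 0 0 *: v + u 0 1 *: w = 0.
  have -> : u 0 0 *: v + u 0 1 *: w = u *m P.
    by rewrite mulmx_sum_row sum_ord2 -rP0 -rP1.
  by [].
have uPi : i *: (u 0 0 *: v - u 0 1 *: w) = 0.
  have := congr1 (mulmx^~ g1) uP; rewrite mulmxDl mul0mx -!scalemxAl vg1 wg1 => <-.
  by rewrite scalerBr !scalerA mulrN scaleNr ![i * _]mulrC.
move/eqP: uPi; rewrite scaler_eq0 (negPf i_neq0) subr_eq0 /= => /eqP uE.
have uw0 : u 0 1 = 0.
  move/eqP: uP; rewrite uE -scalerDl -mulr2n -mulr_natl scaler_eq0 (negPf w_neq0).
  by rewrite orbF mulf_eq0 (negPf two_neq0) => /eqP.
have u0 : u 0 0 = 0.
  by move/eqP: uE; rewrite uw0 scale0r scaler_eq0 (negPf ek0) orbF => /eqP.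
by apply/rowP; elim/ord2_cases; rewrite !mxE.
Qed.

Lemma quat_conj (P g1 g2 k1 k2 : M2) a b c d :
  P * g1 = k1 * P -> P * g2 = k2 * P ->
  P * quat g1 g2 a b c d = quat k1 k2 a b c d * P.
Proof.
move=> P1 P2; rewrite /quat !(mulrDr, mulrDl) -!scalerAr -!scalerAl.
by rewrite mulr1 mul1r P1 P2 mulrA P1 -mulrA P2 mulrA.
Qed.

Section Coordinates.
Variables g1 g2 : M2.
Hypothesis rel : Q8_rel g1 g2.

Lemma quat_conj_std : exists2 P : M2, P \is a GRing.unit &
  forall a b c d, P * quat g1 g2 a b c d = quat std1 std2 a b c d * P.
Proof.
have [P Pu [P1 P2]] := Q8_rel_conj_std rel.
by exists P => // a b c d; apply: quat_conj.
Qed.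

(** Read off from the four entries of the conjugate in the standard basis. *)
Lemma quat_surj x : exists a b c d, x = quat g1 g2 a b c d.
Proof.
have [P Pu PE] := quat_conj_std.
pose y := P * x * P^-1.
pose a := (y 0 0 + y 1 1) / 2; pose b := (y 0 0 - y 1 1) / (2 * i).
pose c := (y 0 1 - y 1 0) / 2; pose d := (y 0 1 + y 1 0) / (2 * i).
exists a, b, c, d; apply: (mulrI Pu); rewrite PE quat_std.
rewrite -[LHS](mulrVK Pu) -/y; congr (_ * P); rewrite [LHS]mx2_eta.
have i0 := i_neq0.
by congr mx2; rewrite /a /b /c /d; field; rewrite ?two_neq0 ?i0.
Qed.

Lemma quat_inj a b c d a' b' c' d' :
  quat g1 g2 a b c d = quat g1 g2 a' b' c' d' ->
  [/\ a = a', b = b', c = c' & d = d'].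
Proof.
have [P Pu PE] := quat_conj_std.
move=> /(congr1 ( *%R P)); rewrite !PE => /(mulIr Pu); rewrite !quat_std => E.
have e00 := congr1 (fun x : M2 => x 0 0) E; have e01 := congr1 (fun x : M2 => x 0 1) E.
have e10 := congr1 (fun x : M2 => x 1 0) E; have e11 := congr1 (fun x : M2 => x 1 1) E.
rewrite !mxE /= in e00 e01 e10 e11; have i0 := i_neq0.
have cancel2 (u v : F) : 2 * u = 2 * v -> u = v by exact: (mulfI two_neq0).
have canceli (u v : F) : 2 * (i * u) = 2 * (i * v) -> u = v.
  by move=> /cancel2; apply: (mulfI i0).
split; [apply: cancel2 | apply: canceli | apply: cancel2 | apply: canceli].
- have -> : 2 * a = (a + i * b) + (a - i * b) by ring.
  by rewrite e00 e11; ring.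
- have -> : 2 * (i * b) = (a + i * b) - (a - i * b) by ring.
  by rewrite e00 e11; ring.
- have -> : 2 * c = (c + i * d) - (- c + i * d) by ring.
  by rewrite e01 e10; ring.
- have -> : 2 * (i * d) = (c + i * d) + (- c + i * d) by ring.
  by rewrite e01 e10; ring.
Qed.

Lemma quat_mul a b c d a' b' c' d' :
  quat g1 g2 a b c d * quat g1 g2 a' b' c' d' =
  quat g1 g2 (a * a' - b * b' - c * c' - d * d')
             (a * b' + b * a' + c * d' - d * c')
             (a * c' + c * a' + d * b' - b * d')
             (a * d' + d * a' + b * c' - c * b').
Proof.
have [P Pu PE] := quat_conj_std; apply: (mulrI Pu).
rewrite mulrA !PE -mulrA PE mulrA; congr (_ * P).
by rewrite !quat_std mx2_mul; congr mx2; ring: i2.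
Qed.

Lemma det_quat a b c d :
  \det (quat g1 g2 a b c d) = a ^+ 2 + b ^+ 2 + c ^+ 2 + d ^+ 2.
Proof.
have [P Pu PE] := quat_conj_std.
have -> : quat g1 g2 a b c d = P^-1 * (quat std1 std2 a b c d * P).
  by rewrite -PE mulKr.
rewrite -!mulmxE !det_mulmx mulrCA -det_mulmx mulmxE mulVr // det1 mulr1.
by rewrite quat_std det_mx2 !mxE /=; ring: i2.
Qed.

Lemma tr_quat a b c d : \tr (quat g1 g2 a b c d) = 2 * a.
Proof.
have [P Pu PE] := quat_conj_std.
have -> : quat g1 g2 a b c d = P^-1 * (quat std1 std2 a b c d * P).
  by rewrite -PE mulKr.
rewrite -!mulmxE mxtrace_mulC mulmxE -mulrA divrr // mulr1.
by rewrite quat_std trace_mx2 !mxE /=; ring.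
Qed.

Lemma quat_g1 : quat g1 g2 0 1 0 0 = g1.
Proof. by rewrite /quat scale1r !scale0r !addr0 add0r. Qed.

Lemma quat_g2 : quat g1 g2 0 0 1 0 = g2.
Proof. by rewrite /quat scale1r !scale0r !addr0 !add0r. Qed.

Lemma quat_scalar a : quat g1 g2 a 0 0 0 = a%:M.
Proof. by rewrite /quat !scale0r !addr0 scalemx1. Qed.

Lemma quat_scale k a b c d :
  k *: quat g1 g2 a b c d = quat g1 g2 (k * a) (k * b) (k * c) (k * d).
Proof. by rewrite /quat !scalerDr !scalerA. Qed.

Lemma quat_opp a b c d :
  - quat g1 g2 a b c d = quat g1 g2 (- a) (- b) (- c) (- d).
Proof. by rewrite /quat !scaleNr !opprD. Qed.

Lemma quat_mul_gens a b c d :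
  [/\ quat g1 g2 a b c d * g1 = quat g1 g2 (- b) a d (- c),
      quat g1 g2 a b c d * g2 = quat g1 g2 (- c) (- d) a b,
      g1 * quat g1 g2 a b c d = quat g1 g2 (- b) a (- d) c &
      g2 * quat g1 g2 a b c d = quat g1 g2 (- c) d a (- b)].
Proof.
have := (quat_mul a b c d 0 1 0 0, quat_mul a b c d 0 0 1 0,
         quat_mul 0 1 0 0 a b c d, quat_mul 0 0 1 0 a b c d).
rewrite quat_g1 quat_g2 => -[[[-> ->] ->] ->].
by split; congr quat; ring.
Qed.

(** Schur's lemma for Q: each coordinate other than the first is negated by
    conjugation by g1 or by g2. *)
Lemma quat_centre x : x * g1 = g1 * x -> x * g2 = g2 * x -> exists c, x = c%:M.
Proof.
have [a [b [c [d ->]]]] := quat_surj x.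
have [-> -> -> ->] := quat_mul_gens a b c d.
have self_opp (u : F) : u = - u -> u = 0.
  move/eqP; rewrite -subr_eq0 opprK -mulr2n -mulr_natl mulf_eq0.
  by rewrite (negPf two_neq0) => /eqP.
move=> /quat_inj[_ _ /self_opp-> /esym/self_opp->] /quat_inj[_ _ _ /self_opp->].
by exists a; rewrite quat_scalar.
Qed.

Lemma Q8_elt_quat s b c : Q8_elt g1 g2 (s, b, c) =
  quat g1 g2 ((-1) ^+ s * (~~ b && ~~ c)%:R) ((-1) ^+ s * (b && ~~ c)%:R)
             ((-1) ^+ s * (~~ b && c)%:R) ((-1) ^+ s * (b && c)%:R).
Proof.
rewrite -quat_scale; congr (_ *: _); rewrite /quat.
by case: b c => -[]; rewrite ?expr0 ?expr1 ?mulr1 ?mul1r ?scale1r ?scale0r ?addr0 ?add0r.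
Qed.

Lemma Q8_elt_mul t u : Q8_elt g1 g2 (q8_op t u) = Q8_elt g1 g2 t * Q8_elt g1 g2 u.
Proof.
case: t u => [[s b] c] [[s' b'] c'].
rewrite /= -/(Q8_elt g1 g2 (s, b, c)) -/(Q8_elt g1 g2 (s', b', c')).
rewrite -/(Q8_elt g1 g2 (_, b (+) b', c (+) c')) !Q8_elt_quat quat_mul !signr_addb.
move: ((-1) ^+ s) ((-1) ^+ s') => e e'.
by case: b c b' c' => -[] [] [] /=; congr quat; ring.
Qed.

Lemma Q8_elt_inj : injective (Q8_elt g1 g2).
Proof.
have sgn (s s' : bool) : (-1) ^+ s * 1 = (-1) ^+ s' * 1 :> F -> s = s'.
  have neg1 : -1 != 1 :> F.
    by rewrite eq_sym -subr_eq0 opprK -[1 + 1]/2%:R.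
  by rewrite !mulr1; case: s s' => -[] //= /eqP;
     rewrite ?expr0 ?expr1 ?[1 == _]eq_sym (negPf neg1).
have sgn0 (s s' : bool) : (-1) ^+ s * 1 = (-1) ^+ s' * 0 :> F -> False.
  by rewrite mulr0 mulr1 => /eqP; rewrite signr_eq0.
move=> [[s b] c] [[s' b'] c']; rewrite !Q8_elt_quat => /quat_inj[].
case: b c b' c' => -[] [] [] /= E0 E1 E2 E3;
  by [rewrite (sgn s s') | case: (sgn0 s s') | case: (sgn0 s' s)].
Qed.

Lemma Q8_elt_1 : Q8_elt g1 g2 (false, false, false) = 1.
Proof. by rewrite /Q8_elt !expr0 scale1r mulr1. Qed.

Lemma Q8_elt_V t : Q8_elt g1 g2 t \is a GRing.unit /\
  (Q8_elt g1 g2 t)^-1 = Q8_elt g1 g2 (q8_inv t).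
Proof.
have E : Q8_elt g1 g2 t * Q8_elt g1 g2 (q8_inv t) = 1.
  by rewrite -Q8_elt_mul q8_opV Q8_elt_1.
have [tu _] := mulmx1_unit E.
by split=> //; rewrite -[RHS](mulKr tu) E mulr1.
Qed.

Lemma det_Q8_elt t : \det (Q8_elt g1 g2 t) = 1.
Proof.
case: t => -[s b] c; rewrite Q8_elt_quat det_quat.
have e2 : ((-1) ^+ s) ^+ 2 = 1 :> F by rewrite sqrr_sign.
by case: b c => -[] /=; ring: e2.
Qed.

End Coordinates.

End QuaternionCoordinates.

(** * Automorphisms of the quaternion group and its normalizer *)

Definition q8_all : seq (bool * bool * bool) :=
  [:: (false, false, false); (false, false, true);
      (false, true, false); (false, true, true);
      (true, false, false); (true, false, true);
      (true, true, false); (true, true, true)].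

Lemma mem_q8_all t : t \in q8_all.
Proof. by case: t => -[[] []] []. Qed.

Notation q8_one := (false, false, false).
Notation q8_minus := (true, false, false).

(** The endomorphism with values u and v at the generators, for u and v subject
    to the relations [q8_gens]. *)
Definition q8_hom (u v t : bool * bool * bool) : bool * bool * bool :=
  let: (s, b, c) := t in
  q8_op (s, false, false) (q8_op (if b then u else q8_one) (if c then v else q8_one)).

Definition q8_gens (u v : bool * bool * bool) : bool :=
  [&& q8_op u u == q8_minus, q8_op v v == q8_minus &
      q8_op v u == q8_op q8_minus (q8_op u v)].

(** u1, u2 are the images of the generators under an automorphism, v1, v2 the
    new generating pair, and the automorphism is first composed with the
    conjugation by t. The disjuncts are the three types of elements of the
    normalizer: centralizing, rotating and cycling. *)
Definition q8_normal_form (u1 u2 v1 v2 t : bool * bool * bool) : bool :=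
  let f v := q8_hom u1 u2 (q8_op (q8_op t v) (q8_inv t)) in
  [&& q8_gens v1 v2, all (fun w => has (fun w' => q8_hom v1 v2 w' == w) q8_all) q8_all &
   [|| (f v1 == v1) && (f v2 == v2),
       (f v1 == v2) && (f v2 == q8_op q8_minus v1) |
       (f v1 == v2) && (f v2 == q8_op v1 v2)]].

(** The outer automorphism group is S_3, of which the three types represent the
    conjugacy classes; there are only 24 automorphisms to go through. *)
Lemma q8_normal_form_exists u1 u2 : q8_gens u1 u2 ->
  exists v1 v2 t, q8_normal_form u1 u2 v1 v2 t.
Proof.
have : all (fun u1 => all (fun u2 => q8_gens u1 u2 ==>
    has (fun v1 => has (fun v2 => has (q8_normal_form u1 u2 v1 v2)
      q8_all) q8_all) q8_all) q8_all) q8_all by vm_compute.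
move/allP/(_ _ (mem_q8_all u1))/allP/(_ _ (mem_q8_all u2))/implyP => H /H.
by case/hasP => v1 _ /hasP[v2 _ /hasP[t _ E]]; exists v1, v2, t.
Qed.

Lemma Q8_elt_words (F : fieldType) (g1 g2 : 'M[F]_2) :
  [/\ Q8_elt g1 g2 (false, true, false) = g1,
  Q8_elt g1 g2 (true, true, false) = - g1, Q8_elt g1 g2 (false, false, true) = g2,
  Q8_elt g1 g2 (true, false, true) = - g2 & Q8_elt g1 g2 (false, true, true) = g1 * g2].
Proof.
by rewrite /Q8_elt !expr0 !expr1 !mulr1 !mul1r !scaleN1r !scale1r.
Qed.

Section Normalizer.
Variable F : fieldType.
Local Notation M2 := 'M[F]_2.
Variable i : F.
Hypothesis i2 : i * i = -1.
Hypothesis two_neq0 : 2 != 0 :> F.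
Variables g1 g2 : M2.
Hypothesis rel : Q8_rel g1 g2.
Local Notation elt := (Q8_elt g1 g2).
Local Notation eltM := (Q8_elt_mul i2 two_neq0 rel).
Local Notation eltI := (Q8_elt_inj i2 two_neq0 rel).

Lemma Q8_elt_minus : elt q8_minus = -1.
Proof. by rewrite /Q8_elt !expr0 expr1 mulr1 scaleN1r. Qed.

Lemma q8_gens_rel v1 v2 : q8_gens v1 v2 -> Q8_rel (elt v1) (elt v2).
Proof.
case/and3P => /eqP E1 /eqP E2 /eqP E3; split; rewrite -?eltM ?E1 ?E2 ?E3.
- exact: Q8_elt_minus.
- exact: Q8_elt_minus.
- by rewrite eltM Q8_elt_minus mulN1r eltM.
Qed.

Lemma normalizer_hom (h : M2) u1 u2 t : h * g1 = elt u1 * h -> h * g2 = elt u2 * h ->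
  h * elt t = elt (q8_hom u1 u2 t) * h.
Proof.
move=> h1 h2; case: t => -[s b] c.
have Ea : h * g1 ^+ b = elt (if b then u1 else q8_one) * h.
  by case: b; rewrite // Q8_elt_1 mulr1 mul1r.
have Eb : h * g2 ^+ c = elt (if c then u2 else q8_one) * h.
  by case: c; rewrite // Q8_elt_1 mulr1 mul1r.
have -> : elt (s, b, c) = (-1) ^+ s *: (g1 ^+ b * g2 ^+ c) by [].
rewrite -scalerAr mulrA Ea -mulrA Eb mulrA -eltM scalerAl; congr (_ * h).
rewrite /q8_hom [in RHS]eltM.
have -> : elt (s, false, false) = (-1) ^+ s *: 1 by rewrite /Q8_elt !expr0 mulr1.
by rewrite -scalerAl mul1r.
Qed.

Lemma Q8_elt_gens v1 v2 t : Q8_elt (elt v1) (elt v2) t = elt (q8_hom v1 v2 t).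
Proof.
case: t => -[s b] c; rewrite /q8_hom !eltM.
have -> : elt (s, false, false) = (-1) ^+ s *: 1 by rewrite /Q8_elt !expr0 mulr1.
rewrite -scalerAl mul1r {1}/Q8_elt.
by case: b c => -[]; rewrite ?expr0 ?expr1 ?Q8_elt_1.
Qed.

(** The finite search transported to matrices: multiplying h by an element of Q
    composes its action with an inner automorphism. *)
Lemma Q8_normalizer (h : M2) u1 u2 : h \is a GRing.unit ->
  h * g1 = elt u1 * h -> h * g2 = elt u2 * h ->
  exists (k1 k2 : M2) t, let h' := h * elt t in
    [/\ Q8_rel k1 k2, range (Q8_elt k1 k2) = range elt &
     [\/ h' * k1 = k1 * h' /\ h' * k2 = k2 * h',
         h' * k1 = k2 * h' /\ h' * k2 = - k1 * h' |
         h' * k1 = k2 * h' /\ h' * k2 = k1 * k2 * h']].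
Proof.
move=> hu h1 h2; have hom := normalizer_hom _ h1 h2.
have [e1 _ e2 _ _] := Q8_elt_words g1 g2.
have gens : q8_gens u1 u2.
  have conj v w : h * elt v = elt w * h -> w = q8_hom u1 u2 v.
    by rewrite hom => /(mulIr hu)/eltI ->.
  have E1 : u1 = q8_hom u1 u2 (false, true, false) by apply: conj; rewrite e1.
  have E2 : u2 = q8_hom u1 u2 (false, false, true) by apply: conj; rewrite e2.
  have homM v w : q8_hom u1 u2 (q8_op v w) = q8_op (q8_hom u1 u2 v) (q8_hom u1 u2 w).
    by apply/esym/conj; rewrite !eltM mulrA hom -mulrA hom mulrA.
  pose x := (false, true, false); pose y := (false, false, true).
  have [] := (homM x x, homM y y, homM y x, homM x y).
  rewrite -E1 -E2 /q8_gens => -[[<- <-] <-] <-; rewrite /q8_hom /=.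
  by case: (q8_op u1 u2) => -[[] []] [].
have [v1 [v2 [t /and3P[v_gens surj cases]]]] := q8_normal_form_exists gens.
exists (elt v1), (elt v2), t => /=; split; first exact: q8_gens_rel.
  apply/seteqP; split=> _ [w _ <-]; first by exists (q8_hom v1 v2 w); rewrite // Q8_elt_gens.
  have /hasP[w' _ /eqP <-] := allP surj w (mem_q8_all w).
  by exists w'; rewrite // Q8_elt_gens.
have act v : h * elt t * elt v =
    elt (q8_hom u1 u2 (q8_op (q8_op t v) (q8_inv t))) * (h * elt t).
  rewrite mulrA -hom -!mulrA -!eltM; congr (h * elt _).
  by case: t v {surj cases} => -[[] []] [] [[[] []] []].
by case/or3P: cases => /andP[/eqP E1 /eqP E2];
  [apply: Or31 | apply: Or32 | apply: Or33];
  rewrite !act E1 E2 ?eltM ?Q8_elt_minus ?mulN1r.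
Qed.

(** Inner automorphisms preserve the axes: this is what forbids powers of a
    rotating or cycling element from falling into Q too early. *)
Lemma Q8_axis (a : M2) u : elt u * g1 = a * elt u -> a = g1 \/ a = - g1.
Proof.
have [uu _] := Q8_elt_V i2 two_neq0 rel u.
have [e1 e1N _ _ _] := Q8_elt_words g1 g2.
have E : elt u * elt (false, true, false) = elt (u.2, true, false) * elt u.
  by rewrite -!eltM; congr (elt _); case: u {uu} => -[[] []] [].
rewrite e1 in E; rewrite E => /(mulIr uu) <-; case: u.2; last by left.
by right; rewrite -e1N.
Qed.

End Normalizer.

(** * Isomorphisms and cardinals from a common parametrization *)

Lemma range_bij (I T U : Type) (i0 : I) (p : I -> T) (q : I -> U) :
    injective p -> injective q ->
  exists f : T -> U, set_bij (range p) (range q) f /\ forall i, f (p i) = q i.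
Proof.
move=> p_inj q_inj; pose p' := 'pinv_(fun _ => i0) setT p.
have p'K i : p' (p i) = i.
  by rewrite /p' pinvKV ?inE // => x y _ _; apply: p_inj.
exists (q \o p'); split=> [|i]; last by rewrite /= p'K.
split.
- by move=> _ [i _ <-]; exists i; rewrite //= p'K.
- by move=> _ _ /set_mem[i _ <-] /set_mem[j _ <-] /=; rewrite !p'K => /q_inj ->.
- by move=> _ [i _ <-]; exists (p i); [exists i | rewrite /= p'K].
Qed.

Lemma mul_iso_param (I T U : Type) (mulT : T -> T -> T) (mulU : U -> U -> U)
    (i0 : I) (op : I -> I -> I) (p : I -> T) (q : I -> U) :
  injective p -> injective q ->
  (forall i j, p (op i j) = mulT (p i) (p j)) ->
  (forall i j, q (op i j) = mulU (q i) (q j)) ->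
  mul_iso mulT mulU (range p) (range q).
Proof.
move=> p_inj q_inj pM qM; have [f [f_bij fp]] := range_bij i0 p_inj q_inj.
exists f; split=> // _ _ [i _ <-] [j _ <-].
by rewrite -pM !fp qM.
Qed.

Lemma card_range_fin (I : finType) (T : Type) (p : I -> T) (i0 : I) :
  injective p -> range p #= `I_#|I|.
Proof.
move=> p_inj; pose q (i : I) : nat := enum_rank i.
have q_inj : injective q by move=> i j /ord_inj/enum_rank_inj.
have [f [f_bij _]] := range_bij i0 p_inj q_inj.
have -> : `I_#|I| = range q.
  apply/seteqP; split=> [k kI | _ [i _ <-]]; last exact: ltn_ord.
  by exists (enum_val (Ordinal kI)); rewrite // /q enum_valK.
by apply/card_set_bijP; exists f.
Qed.

(** * Groups of matrices over subrings of C *)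

Section MatrixGroups.
Variable R : realType.
Local Notation C := R[i].
Local Notation M2 := 'M[R[i]]_2.
Implicit Types (S : set C) (A K : set M2) (g h x y P : M2).

Lemma sqr_iC : 'i%C * 'i%C = -1 :> C.
Proof. by rewrite -expr2 sqr_i. Qed.

Lemma two_neq0C : 2 != 0 :> C.
Proof. by rewrite pnatr_eq0. Qed.

Lemma GL2_full x : GL2 [set: C] x <-> x \is a GRing.unit.
Proof.
have -> : (x \is a GRing.unit) = (\det x != 0).
  by rewrite -unitfE; apply: unitmxE.
split=> [[_ [_ [v [_ xv]]]] | x0].
  by apply: contra_eq_neq xv => ->; rewrite mul0r eq_sym oner_eq0.
by split=> //; split=> //; exists (\det x)^-1; rewrite mulfV.
Qed.

Definition is_subring S : Prop :=
  [/\ S 1, forall x y : C, S x -> S y -> S (x - y) &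
      forall x y : C, S x -> S y -> S (x * y)].

Lemma subring0 S : is_subring S -> S 0.
Proof. by case=> S1 SB _; rewrite -(subrr 1); apply: SB. Qed.

Lemma subringN S (a : C) : is_subring S -> S a -> S (- a).
Proof. by move=> Sr Sa; rewrite -sub0r; case: (Sr) => _ SB _; apply: SB (subring0 Sr) Sa. Qed.

Lemma subringD S (a b : C) : is_subring S -> S a -> S b -> S (a + b).
Proof.
by move=> Sr Sa Sb; rewrite -[b]opprK; case: (Sr) => _ SB _; apply: SB Sa (subringN Sr Sb).
Qed.

Lemma subringM S (a b : C) : is_subring S -> S a -> S b -> S (a * b).
Proof. by case=> _ _; apply. Qed.

Lemma subring_nat S n : is_subring S -> S n%:R.
Proof.
move=> Sr; elim: n => [|n IHn]; first exact: subring0.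
by rewrite -addn1 natrD; apply: subringD => //; case: Sr.
Qed.

Lemma subring_int S (m : int) : is_subring S -> S m%:~R.
Proof.
move=> Sr; case: m => n; first exact: subring_nat.
by rewrite NegzE mulrNz; apply: subringN Sr (subring_nat _ Sr).
Qed.

Lemma subringT : is_subring [set: C].
Proof. by []. Qed.

Lemma GL2_mx2 S (a b c d : C) : is_subring S ->
  S a -> S b -> S c -> S d -> units S (a * d - b * c) -> GL2 S (mx2 a b c d).
Proof.
move=> Sr Sa Sb Sc Sd Su; split; first by elim/ord2_cases; elim/ord2_cases; rewrite mxE.
by rewrite det_mx2 !mxE /=.
Qed.

(** The inverse of a two-by-two matrix is its adjugate divided by the
    determinant, so it has entries in S when the determinant is a unit of S. *)
Lemma GL2_subgroup S : is_subring S -> mx_subgroup (GL2 setT) (GL2 S).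
Proof.
move=> Sr; case: (Sr) => S1 SB SM; split.
- by move=> x [_ [_ [v [_ xv]]]]; split=> //; split=> //; exists v.
- rewrite mx2_1; apply: GL2_mx2 => //; try exact: subring0.
  by rewrite mulr1 mulr0 subr0; split=> //; exists 1; rewrite mulr1.
- move=> x y [Sx [Sdx [v [Sv xv]]]] [Sy [Sdy [w [Sw yw]]]]; split.
    by move=> i j; rewrite -mulmxE mxE sum_ord2; apply: subringD => //; apply: SM.
  rewrite -mulmxE det_mulmx; split; first exact: SM.
  by exists (v * w); split; [exact: SM | rewrite mulrACA xv yw mulr1].
- move=> x [Sx [Sdx [v [Sv xv]]]].
  have xu : x \is a GRing.unit by apply/GL2_full; split=> //; split=> //; exists v.
  have -> : x^-1 = mx2 (v * x 1 1) (- (v * x 0 1)) (- (v * x 1 0)) (v * x 0 0).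
    apply: (mulrI xu); rewrite divrr //; rewrite [X in X * _]mx2_eta mx2_mul mx2_1.
    rewrite det_mx2 in xv.
    by congr mx2; rewrite -?xv; ring.
  apply: GL2_mx2 => //; do ?[apply: subringN => //]; try exact: SM.
  rewrite !mulrN !mulNr opprK.
  have -> : v * x 1 1 * (v * x 0 0) - v * x 0 1 * (v * x 1 0) = v.
    by rewrite -[RHS]mulr1 -xv det_mx2; ring.
  by split=> //; exists (\det x); rewrite mulrC.
Qed.

Section Generation.
Variable A : set M2.
Hypothesis A_inv : A `<=` GL2 [set: C].

Lemma mx_generated_subgroup : mx_subgroup (GL2 setT) (mx_generated A).
Proof.
have [_ G1 GM GV] := GL2_subgroup subringT; split.
- by move=> x; apply; split=> //; split.
- by move=> K [[_ K1 _ _] _].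
- by move=> x y Ax Ay K KA; case: (KA) => -[_ _ KM _] _; apply: KM; [apply: Ax | apply: Ay].
- by move=> x Ax K KA; case: (KA) => -[_ _ _ KV] _; apply: KV; apply: Ax.
Qed.

Lemma sub_mx_generated : A `<=` mx_generated A.
Proof. by move=> x Ax K [_ AK]; apply: AK. Qed.

End Generation.

Lemma mx_generated_min A K :
  mx_subgroup (GL2 setT) K -> A `<=` K -> mx_generated A `<=` K.
Proof. by move=> Kg AK x; apply. Qed.

End MatrixGroups.

(** * The quaternion group as a set of matrices *)

(** With x of order 4, y^2 = x^2 and x^y = x^-1, the triple (s, b, c) is
    x^(2 s + b) y^c; injectivity and the order 8 give surjectivity. *)
Lemma quaternion8_param : exists p : bool * bool * bool -> 'Q_8,
  [/\ injective p, range p = setT & forall t u, p (q8_op t u) = (p t * p u)%g].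
Proof.
have [[x y] /= [oG xG ox yx] [oy y2 xy]] :=
  @generators_quaternion _ [set: 'Q_8]%G 3 isT (isog_refl _).
pose p (t : bool * bool * bool) : 'Q_8 :=
  let: (s, b, c) := t in (x ^+ (2 * s + b) * y ^+ c)%g.
have x4 : (x ^+ 4 = 1)%g by have := expg_order x; rewrite ox.
have yy : (y * y = x ^+ 2)%g by rewrite -expg2 y2.
have xyi : (y * x = x ^+ 3 * y)%g.
  have xV : (x^-1 = x ^+ 3)%g by apply: (mulgI x); rewrite mulgV -expgS x4.
  rewrite -xV -xy conjgE; apply: (mulgI y).
  by rewrite !mulgA mulgV mul1g yy -mulgA yy -expgS -expgSr.
have yX n : (y * x ^+ n = x ^+ (3 * n) * y)%g.
  elim: n => [|n IHn]; first by rewrite muln0 !expg0 mulg1 mul1g.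
  by rewrite expgSr mulgA IHn -mulgA xyi mulgA -expgD mulnSr.
have xmod m n : m = n %[mod 4] -> (x ^+ m = x ^+ n)%g.
  by move=> mn; rewrite -(expg_mod m x4) mn expg_mod.
have pM t u : p (q8_op t u) = (p t * p u)%g.
  case: t u => [[s b] c] [[s' b'] c']; rewrite /p /=.
  have yc : (y ^+ c * x ^+ (2 * s' + b') =
             x ^+ ((if c then 3 else 1) * (2 * s' + b'))%N * y ^+ c)%g.
    by case: c; rewrite ?expg1 ?yX // !expg0 mul1n mulg1 mul1g.
  have ycc : (y ^+ c * y ^+ c' = x ^+ (2 * (c && c')) * y ^+ (c (+) c'))%g.
    by clear yc; case: c c' => -[]; rewrite ?expg0 ?expg1 ?mulg1 ?mul1g.
  rewrite -mulgA [(y ^+ c * _)%g]mulgA yc -mulgA ycc !mulgA -!expgD.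
  congr (_ * _)%g; apply: xmod; clear yc ycc.
  by case: s b c s' b' c' => -[] [] [] [] [].
have notXy k : (y != x ^+ k)%g.
  by move: yx; rewrite inE => /andP[+ _]; apply: contra => /eqP ->; apply: mem_cycle.
have xk0 k : (k < 4)%N -> (x ^+ k = 1)%g -> k = 0%N.
  move=> k4 /eqP; rewrite -order_dvdn ox => /dvdnP[[|m] //]; lia.
have p_inj : injective p.
  suff p1 t : p t = 1%g -> t = (false, false, false).
    move=> t u tu; have : p (q8_op t (q8_inv u)) = 1%g.
      by rewrite pM tu -pM q8_opV /p !expg0 mulg1.
    move/p1; case: t u {tu} => [[[] []] []] [[[] []] []] //.
  case: t => -[s b] []; rewrite /p ?expg0 ?expg1 ?mulg1 => E.
    have /eqP[] := notXy (3 * (2 * s + b))%N.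
    apply: (mulgI (x ^+ (2 * s + b))%g); rewrite E -expgD -mulSn expgM x4.
    by rewrite expg1n.
  by have := xk0 _ _ E; case: s b {E} => -[] // /(_ isT).
exists p; split=> //.
apply/seteqP; split=> // g _.
have [q _ pq] : bijective p by apply: inj_card_bij; rewrite // -cardsT oG !card_prod !card_bool.
by exists (q g).
Qed.

Section Q8Elements.
Variable R : realType.
Local Notation C := R[i].
Local Notation M2 := 'M[R[i]]_2.
Local Notation iC2 := (sqr_iC R).
Local Notation two0 := (two_neq0C R).
Implicit Types (S : set C) (A K : set M2) (g h x y P : M2).

Section Fixed.
Variables g1 g2 : M2.
Hypothesis rel : Q8_rel g1 g2.

Lemma Q8_rel_GL2 : [set g1; g2] `<=` GL2 [set: C].
Proof.
move=> x; rewrite GL2_full => -[] ->.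
- have := (Q8_elt_V iC2 two0 rel (false, true, false)).1.
  by rewrite /= expr0 expr1 mulr1 scale1r.
- have := (Q8_elt_V iC2 two0 rel (false, false, true)).1.
  by rewrite /= expr0 expr1 mul1r scale1r.
Qed.

(** The eight elements are closed under products and inverses, and -1 is a word
    in the generators since it is the square of g1. *)
Lemma mx_generated_Q8 : mx_generated [set g1; g2] = range (Q8_elt g1 g2).
Proof.
apply/seteqP; split.
- apply: mx_generated_min; first split.
  + by move=> _ [t _ <-]; apply/GL2_full; case: (Q8_elt_V iC2 two0 rel t).
  + by exists (false, false, false); rewrite // Q8_elt_1.
  + by move=> _ _ [t _ <-] [u _ <-]; exists (q8_op t u); rewrite // (Q8_elt_mul iC2 two0 rel).
  + by move=> _ [t _ <-]; exists (q8_inv t); case: (Q8_elt_V iC2 two0 rel t).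
  + move=> x [] ->; [exists (false, true, false) | exists (false, false, true)] => //.
      by rewrite /= expr0 expr1 mulr1 scale1r.
    by rewrite /= expr0 expr1 mul1r scale1r.
- have [_ G1 GM GV] := mx_generated_subgroup Q8_rel_GL2.
  have Gg1 : mx_generated [set g1; g2] g1 by apply: sub_mx_generated; left.
  have Gg2 : mx_generated [set g1; g2] g2 by apply: sub_mx_generated; right.
  have GN : mx_generated [set g1; g2] (-1) by case: rel => <- _ _; apply: GM.
  move=> _ [[[s b] c] _ <-].
  have -> : Q8_elt g1 g2 (s, b, c) = (-1) ^+ s * (g1 ^+ b * g2 ^+ c).
    by case: s; rewrite /= ?expr1 ?expr0 ?scaleN1r ?scale1r ?mulN1r ?mul1r.
  by apply: (GM); [case: s | apply: (GM); [case: b | case: c]];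
    rewrite ?expr0 ?expr1.
Qed.

Lemma Q8_rel_generators : Q8_generators g1 g2.
Proof.
have [p [p_inj p_range pM]] := quaternion8_param.
case: (rel) => g11 g22 g21; split; rewrite ?expr2 // mx_generated_Q8.
rewrite -p_range.
apply: (mul_iso_param (false, false, false) (Q8_elt_inj iC2 two0 rel) p_inj) pM.
exact: (Q8_elt_mul iC2 two0 rel).
Qed.

End Fixed.

Lemma Q8_generators_rel g1 g2 : Q8_generators g1 g2 -> Q8_rel g1 g2.
Proof. by case; rewrite !expr2. Qed.

End Q8Elements.

(** * Extensions of the quaternion group by one normalizing element *)

Section CyclicExtension.
Variable R : realType.
Local Notation C := R[i].
Local Notation M2 := 'M[R[i]]_2.
Local Notation iC2 := (sqr_iC R).
Local Notation two0 := (two_neq0C R).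
Implicit Types (S : set C) (A K : set M2).

Variables (g1 g2 h : M2) (s : nat).
Hypothesis rel : Q8_rel g1 g2.
Local Notation elt := (Q8_elt g1 g2).

Definition normalizes_Q8 : Prop := exists t1 t2, h * g1 = elt t1 * h /\ h * g2 = elt t2 * h.

Lemma normalizes_Q8_elt : normalizes_Q8 -> forall t, exists u, h * elt t = elt u * h.
Proof.
move=> [t1 [t2 [h1 h2]]] t; exists (q8_hom t1 t2 t).
exact: (normalizer_hom iC2 two0 rel t h1 h2).
Qed.

Hypothesis h_unit : h \is a GRing.unit.
Hypothesis h_norm : normalizes_Q8.
Hypothesis det_h : s.-primitive_root (\det h).
Hypothesis h_pow : exists t, h ^+ s = elt t.

Let s_gt0 : (0 < s)%N := prim_order_gt0 det_h.

(** Normal forms q h^k with k < s; the determinant recovers k, and then q. *)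
Definition ext_elt (p : 'I_s * (bool * bool * bool)) : M2 := elt p.2 * h ^+ p.1.

Lemma normalizes_Q8_exp n t : exists u, h ^+ n * elt t = elt u * h ^+ n.
Proof.
elim: n => [|n [u IHn]]; first by exists t; rewrite expr0 mulr1 mul1r.
have [v hv] := normalizes_Q8_elt h_norm u.
by exists v; rewrite exprS -mulrA IHn mulrA hv mulrA.
Qed.

Lemma ext_eltP x : range ext_elt x <-> exists t n, x = elt t * h ^+ n.
Proof.
split=> [[[k t] _ <-] | [t [n ->]]]; first by exists t, k.
have [u hs] := h_pow.
have [v hv] : exists v, h ^+ (n %/ s * s) = elt v.
  elim: (n %/ s)%N => [|m [v hv]].
    by exists (false, false, false); rewrite mul0n expr0 (Q8_elt_1 g1 g2).
  by exists (q8_op u v); rewrite mulSn exprD hs hv (Q8_elt_mul iC2 two0 rel).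
exists (Ordinal (ltn_pmod n s_gt0), q8_op t v) => //.
by rewrite /ext_elt /= (Q8_elt_mul iC2 two0 rel) -hv -mulrA -exprD -divn_eq.
Qed.

Lemma ext_elt_mul x y : range ext_elt x -> range ext_elt y -> range ext_elt (x * y).
Proof.
move=> /ext_eltP[t [n ->]] /ext_eltP[u [m ->]]; apply/ext_eltP.
have [v hv] := normalizes_Q8_exp n u.
exists (q8_op t v), (n + m)%N.
by rewrite (Q8_elt_mul iC2 two0 rel) exprD -!mulrA (mulrA _ _ (h ^+ m)) hv !mulrA.
Qed.

Lemma ext_elt_Q8 t : range ext_elt (elt t).
Proof. by apply/ext_eltP; exists t, 0; rewrite expr0 mulr1. Qed.

Lemma ext_elt_exp n : range ext_elt (h ^+ n).
Proof.
by apply/ext_eltP; exists (false, false, false), n; rewrite (Q8_elt_1 g1 g2) mul1r.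
Qed.

Lemma mx_generated_ext : mx_generated [set g1; g2; h] = range ext_elt.
Proof.
have gens : [set g1; g2; h] `<=` GL2 [set: C].
  by move=> x [/(Q8_rel_GL2 rel) // | ->]; apply/GL2_full.
have [_ G1 GM GV] := mx_generated_subgroup gens.
have GX x n : mx_generated [set g1; g2; h] x -> mx_generated [set g1; g2; h] (x ^+ n).
  by move=> Gx; elim: n => [|n IHn]; rewrite ?expr0 // exprS; apply: GM.
have GQ t : mx_generated [set g1; g2; h] (elt t).
  have : mx_generated [set g1; g2] (elt t) by rewrite mx_generated_Q8 //; exists t.
  apply: mx_generated_min; first exact: mx_generated_subgroup.
  by move=> x gx; apply: sub_mx_generated; left.
apply/seteqP; split; last first.
  move=> _ [[k t] _ <-]; apply: GM => //; apply: GX.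
  by apply: sub_mx_generated; right.
apply: mx_generated_min; first split.
- move=> _ /ext_eltP[t [n ->]]; apply/GL2_full.
  by rewrite unitrMl ?unitrX // (Q8_elt_V iC2 two0 rel t).1.
- exact: (ext_elt_exp 0).
- by move=> x y; apply: ext_elt_mul.
- have [u hs] := h_pow.
  (* h^s lies in Q, so the inverse of h is again a positive word. *)
  have hV : range ext_elt h^-1.
    have -> : h^-1 = h ^+ s.-1 * elt (q8_inv u).
      rewrite -(Q8_elt_V iC2 two0 rel u).2 -hs; apply: (mulrI h_unit).
      by rewrite divrr // mulrA -exprS prednK // divrr // unitrX.
    apply: ext_elt_mul; [exact: ext_elt_exp | exact: ext_elt_Q8].
  have hVX n : range ext_elt (h^-1 ^+ n).
    elim: n => [|n IHn]; first exact: (ext_elt_exp 0).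
    by rewrite exprS; apply: ext_elt_mul.
  move=> _ /ext_eltP[t [n ->]]; rewrite invrM ?unitrX ?(Q8_elt_V iC2 two0 rel t).1 //.
  rewrite (Q8_elt_V iC2 two0 rel t).2 -exprVn; apply: ext_elt_mul => //.
  exact: ext_elt_Q8.
- move=> x [[] | ] ->; last exact: (ext_elt_exp 1).
    have := ext_elt_Q8 (false, true, false).
    by rewrite /Q8_elt expr0 expr1 mulr1 scale1r.
  have := ext_elt_Q8 (false, false, true).
  by rewrite /Q8_elt expr0 expr1 mul1r scale1r.
Qed.

Lemma det_mxX (x : M2) n : \det (x ^+ n) = \det x ^+ n.
Proof.
by elim: n => [|n IHn]; rewrite ?expr0 ?det1 // !exprS -mulmxE det_mulmx IHn.
Qed.

Lemma ext_elt_det p : \det (ext_elt p) = \det h ^+ p.1.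
Proof.
by rewrite /ext_elt -mulmxE det_mulmx (det_Q8_elt iC2 two0 rel) mul1r det_mxX.
Qed.

Lemma ext_elt_inj : injective ext_elt.
Proof.
move=> [k t] [l u] E; have := congr1 (@determinant _ _) E; rewrite !ext_elt_det /=.
move/eqP; rewrite (eq_prim_root_expr det_h) !modn_small // => /eqP/val_inj kl.
move: E; rewrite /ext_elt /= kl.
by move=> /(mulIr (unitrX _ h_unit))/(Q8_elt_inj iC2 two0 rel) ->.
Qed.

Lemma card_mx_generated_ext : mx_generated [set g1; g2; h] #= `I_(8 * s).
Proof.
rewrite mx_generated_ext.
have := card_range_fin (Ordinal s_gt0, (false, false, false)) ext_elt_inj.
by rewrite !card_prod !card_bool card_ord mulnC.
Qed.

(** det (q h^k) = (det h)^k is 1 for no 0 < k < s. *)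
Lemma mx_generated_ext_SL S : is_subring S ->
  mx_generated [set g1; g2; h] `<=` GL2 S ->
  mx_generated [set g1; g2; h] `&` SL2 S = mx_generated [set g1; g2].
Proof.
move=> Sr KS; rewrite mx_generated_Q8 //; apply/seteqP; split=> [x [] | x [t _ <-]].
  rewrite mx_generated_ext => -[[k t] _ <-] [_].
  rewrite ext_elt_det /= -[RHS](expr0 (\det h)) => /eqP.
  rewrite (eq_prim_root_expr det_h) mod0n modn_small // => /eqP k0.
  by exists t => //; rewrite /ext_elt /= k0 expr0 mulr1.
have Kt : mx_generated [set g1; g2; h] (elt t).
  by rewrite mx_generated_ext; apply: ext_elt_Q8.
by split=> //; split; [apply: KS | apply: (det_Q8_elt iC2 two0 rel)].
Qed.

End CyclicExtension.

(** * The nine third generators *)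

Section NormalFormElements.
Variable F : fieldType.
Local Notation M2 := 'M[F]_2.
Variables i z w k : F.
Hypothesis i2 : i * i = -1.
Hypothesis two_neq0 : 2 != 0 :> F.
Hypothesis z2 : z * z = i.
Hypothesis w2 : w * w = - w - 1.
Hypothesis k2 : k * k = - 2^-1.

(** The third generator of the n-th group in quaternion coordinates.  Up to a
    scalar it is forced by the conjugation action: 1 + g1 g2 rotates,
    g1 + g2 exchanges g1 and g2, 1 + g1 + g2 + g1 g2 cycles, g1 g2 negates g1
    and g2.  The scalar then adjusts the determinant, which is 2 c^2, 2 c^2,
    4 c^2 or c^2.  Here z is a primitive eighth root of unity, w a primitive
    cube root of unity and k = sqrt(-2) / 2. *)
Definition HQ8_elt (n : nat) (g1 g2 : M2) : M2 :=
  match n with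
  | 1 => quat g1 g2 i 0 0 0
  | 2 => quat g1 g2 0 0 0 i
  | 3 => let c := z * (1 + i) / 2 in quat g1 g2 c 0 0 c
  | 4 => quat g1 g2 0 k k 0
  | 5 => quat g1 g2 w 0 0 0
  | 6 => let c := - (w * w / 2) in quat g1 g2 c c c c
  | 7 => quat g1 g2 0 0 0 z
  | 8 => let c := (1 + i) / 2 in quat g1 g2 0 c c 0
  | 9 => let c := (1 + i) / 2 in quat g1 g2 c 0 0 c
  | _ => 1
  end.

(** Images of g1 and g2 under conjugation by the third generator. *)
Definition HQ8_act (n : nat) (g1 g2 : M2) : M2 * M2 :=
  match n with
  | 2 | 7 => (- g1, - g2)
  | 3 | 9 => (g2, - g1)
  | 4 | 8 => (g2, g1)
  | 6 => (g2, g1 * g2)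
  | _ => (g1, g2)
  end.

Definition HQ8_det (n : nat) : F :=
  match n with
  | 1 | 2 | 3 | 4 => -1
  | 5 => w * w
  | 6 => w
  | _ => i
  end.

(** The order of the determinant, that is the index of Q in the n-th group. *)
Definition HQ8_index (n : nat) : nat :=
  match n with
  | 1 | 2 | 3 | 4 => 2
  | 5 | 6 => 3
  | _ => 4
  end.

(** The element of Q to which the third generator is raised by its index. *)
Definition HQ8_pow (n : nat) : bool * bool * bool :=
  match n with
  | 1 | 7 | 8 => (true, false, false)
  | 3 => (true, true, true)
  | _ => (false, false, false)
  end.

Lemma nat_ind19 (P : nat -> Prop) :
  P 1%N -> P 2%N -> P 3%N -> P 4%N -> P 5%N -> P 6%N -> P 7%N -> P 8%N -> P 9%N ->
  forall n, (1 <= n <= 9)%N -> P n.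
Proof. by move=> ? ? ? ? ? ? ? ? ?; do 10?[case=> //]. Qed.

Section Fixed.
Variables g1 g2 : M2.
Hypothesis rel : Q8_rel g1 g2.
Local Notation qmul := (quat_mul i2 two_neq0 rel).
Local Notation gens := (quat_mul_gens i2 two_neq0 rel).

Lemma rot_act c : let h := quat g1 g2 c 0 0 c in
  h * g1 = g2 * h /\ h * g2 = - g1 * h.
Proof.
have [/= -> -> E1 E2] := gens c 0 0 c.
by rewrite mulNr E1 E2 quat_opp; split; congr quat; ring.
Qed.

Lemma swap_act c : let h := quat g1 g2 0 c c 0 in
  h * g1 = g2 * h /\ h * g2 = g1 * h.
Proof.
have [/= -> -> -> ->] := gens 0 c c 0.
by split; congr quat; ring.
Qed.

Lemma cycle_act c : let h := quat g1 g2 c c c c in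
  h * g1 = g2 * h /\ h * g2 = g1 * g2 * h.
Proof.
have [/= -> -> _ E2] := gens c c c c; have [_ _ E1 _] := gens (- c) c c (- c).
by rewrite -mulrA E2 E1; split; congr quat; ring.
Qed.

Lemma neg_act c : let h := quat g1 g2 0 0 0 c in
  h * g1 = - g1 * h /\ h * g2 = - g2 * h.
Proof.
have [/= -> -> E1 E2] := gens 0 0 0 c.
by rewrite !mulNr E1 E2 !quat_opp; split; congr quat; ring.
Qed.

Lemma scalar_act c : let h := quat g1 g2 c 0 0 0 in
  h * g1 = g1 * h /\ h * g2 = g2 * h.
Proof. by have [/= -> -> -> ->] := gens c 0 0 0; split; congr quat; ring. Qed.

Lemma HQ8_elt_act n : (1 <= n <= 9)%N ->
  HQ8_elt n g1 g2 * g1 = (HQ8_act n g1 g2).1 * HQ8_elt n g1 g2 /\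
  HQ8_elt n g1 g2 * g2 = (HQ8_act n g1 g2).2 * HQ8_elt n g1 g2.
Proof.
by elim/nat_ind19; [apply: scalar_act | apply: neg_act | apply: rot_act |
  apply: swap_act | apply: scalar_act | apply: cycle_act | apply: neg_act |
  apply: swap_act | apply: rot_act].
Qed.

Lemma HQ8_elt_det n : (1 <= n <= 9)%N -> \det (HQ8_elt n g1 g2) = HQ8_det n.
Proof.
elim/nat_ind19; rewrite /= (det_quat i2 two_neq0 rel) ?expr0n /= ?addr0 ?add0r ?expr2.
- by [].
- by [].
- by field: z2 i2.
- by rewrite k2; field.
- by [].
- by field: w2.
- by [].
- by field: i2.
- by field: i2.
Qed.

Lemma rot_sqr c : quat g1 g2 c 0 0 c ^+ 2 = quat g1 g2 0 0 0 (2 * (c * c)).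
Proof. by rewrite expr2 qmul; congr quat; ring. Qed.

Lemma swap_sqr c : quat g1 g2 0 c c 0 ^+ 2 = (- (2 * (c * c)))%:M.
Proof. by rewrite expr2 qmul -(quat_scalar g1 g2); congr quat; ring. Qed.

Lemma neg_sqr c : quat g1 g2 0 0 0 c ^+ 2 = (- (c * c))%:M.
Proof. by rewrite expr2 qmul -(quat_scalar g1 g2); congr quat; ring. Qed.

Lemma cycle_cube c : quat g1 g2 c c c c ^+ 3 = (- (8 * (c * c * c)))%:M.
Proof. by rewrite !exprS expr0 mulr1 !qmul -(quat_scalar g1 g2); congr quat; ring. Qed.

Lemma HQ8_elt_pow n : (1 <= n <= 9)%N ->
  HQ8_elt n g1 g2 ^+ HQ8_index n = Q8_elt g1 g2 (HQ8_pow n).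
Proof.
have pow4 (x : M2) : x ^+ 4 = (x ^+ 2) ^+ 2 by rewrite -exprM.
have one : Q8_elt g1 g2 (false, false, false) = 1%:M by rewrite Q8_elt_1.
have none : Q8_elt g1 g2 (true, false, false) = (-1)%:M.
  by rewrite /Q8_elt !expr0 expr1 mulr1 scalemx1.
have scM (a b : F) : a%:M * b%:M = (a * b)%:M :> M2 by rewrite -mulmxE -scalar_mxM.
elim/nat_ind19; rewrite [HQ8_pow _]/= ?one ?none [HQ8_index _]/= [HQ8_elt _ _ _]/=
  ?quat_scalar ?pow4 ?rot_sqr ?swap_sqr ?neg_sqr ?cycle_cube ?exprS ?expr0
  ?mulr1 ?scM.
- by rewrite i2.
- by rewrite i2 opprK.
- rewrite Q8_elt_quat; congr quat; rewrite /= ?mulr0 ?mulr1 ?expr1 //.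
  by field: z2 i2.
- by rewrite k2; congr (_%:M); field.
- by rewrite w2; congr (_%:M); ring: w2.
- by congr (_%:M); field: w2.
- by rewrite z2; congr (_%:M); ring: i2.
- by congr (_%:M); field: i2.
- by congr (_%:M); field: i2.
Qed.

End Fixed.
End NormalFormElements.

Lemma root8_inv (F : fieldType) (i z y : F) :
  i * i = -1 -> z * z = i -> z * y = 1 -> y = - (z * i).
Proof.
move=> i2 z2 zy; have -> : y = - (i * i) * y by rewrite i2; ring.
by rewrite -{1}z2 -[RHS]mulr1 -zy; ring.
Qed.

Lemma cube_root_eq (F : fieldType) (w : F) :
  w * w * w = 1 -> w - 1 != 0 -> w * w = - w - 1.
Proof.
move=> w3 w1; apply/eqP; rewrite -subr_eq0; apply/eqP/(mulfI w1).
have -> : (w - 1) * (w * w - (- w - 1)) = w * w * w - 1 by ring.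
by rewrite w3 subrr mulr0.
Qed.

Lemma prim_root_neq0 (F : fieldType) n (x : F) : n.-primitive_root x -> x != 0.
Proof.
move=> prx; apply: contra_eq_neq (prim_expr_order prx) => ->.
by rewrite expr0n gtn_eqF ?(prim_order_gt0 prx) // eq_sym oner_eq0.
Qed.

Lemma prim_root2 (F : fieldType) : 2 != 0 :> F -> 2.-primitive_root (-1 : F).
Proof.
move=> two_neq0; have m1 : -1 != 1 :> F by rewrite eq_sym -subr_eq0 opprK.
apply/andP; split=> //; apply/forallP => -[[|[|[]]] // ?];
  rewrite unity_rootE ?expr1 ?expr2 ?mulrNN ?mulr1 ?eqxx //.
by rewrite (negPf m1).
Qed.

Lemma prim_root3 (F : fieldType) (w : F) :
  3 != 0 :> F -> w * w = - w - 1 -> 3.-primitive_root w.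
Proof.
move=> three_neq0 w2; have w1 : w != 1.
  apply: contra_neq three_neq0 => w1; have -> : 3 = w * w + w + 1 :> F.
    by rewrite w1; ring.
  by rewrite w2; ring.
have w3 : w * w * w = 1 by rewrite w2 mulrBl mulNr w2; ring.
have ww : w * w != 1.
  by apply: contra_neq w1 => E; rewrite -w3 E mul1r.
apply/andP; split=> //; apply/forallP => -[[|[|[|[]]]] // ?];
  rewrite unity_rootE ?exprS ?expr0 ?mulr1 ?mulrA ?w3 ?eqxx //.
  by rewrite (negPf w1).
by rewrite (negPf ww).
Qed.

Lemma prim_root4 (F : fieldType) (i : F) :
  2 != 0 :> F -> i * i = -1 -> 4.-primitive_root i.
Proof.
move=> two_neq0 i2; have m1 : -1 != 1 :> F by rewrite eq_sym -subr_eq0 opprK.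
have i1 : i != 1 by apply: contra_neq m1 => i1; rewrite -i2 i1 mulr1.
have i3 : -1 * i != 1.
  apply: contra_neq m1; rewrite mulN1r => i3.
  by rewrite -i2 -mulrNN i3 mulr1.
apply/andP; split=> //; apply/forallP => -[[|[|[|[|[]]]]] // ?];
  rewrite unity_rootE ?exprS ?expr0 ?mulr1 ?mulrA ?i2 ?mulN1r ?mulNr ?i2 ?opprK ?eqxx //.
- by rewrite (negPf i1).
- by rewrite (negPf m1).
- by rewrite -mulN1r (negPf i3).
Qed.

Section Constants.
Variable R : realType.
Local Notation C := R[i].

Lemma expiD (a b : R) : expi (a + b) = expi a * expi b.
Proof.
by rewrite /expi cosD sinD; simpc; congr (_ +i* _); rewrite addrC.
Qed.

Lemma expi0 : expi (0 : R) = 1.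
Proof. by rewrite /expi cos0 sin0. Qed.

Lemma expi_pihalf : expi (pi / 2 : R) = 'i%C.
Proof. by rewrite /expi cos_pihalf sin_pihalf. Qed.

Lemma expi_2pi : expi (2 * pi : R) = 1.
Proof.
have -> : 2 * pi = pi / 2 + pi / 2 + (pi / 2 + pi / 2) :> R by field.
by rewrite !expiD !expi_pihalf sqr_iC mulrNN mulr1.
Qed.

Definition zeta8 : C := expi (pi / 4).
Definition omega3 : C := expi (2 * pi / 3).

Lemma zeta8_sqr : zeta8 * zeta8 = 'i%C.
Proof. by rewrite -expiD -expi_pihalf; congr expi; field. Qed.

Lemma expi_3pi4 : expi (3 * pi / 4 : R) = zeta8 * 'i%C.
Proof. by rewrite -expi_pihalf -expiD; congr expi; field. Qed.

Lemma expi_Npi4 : expi (- (pi / 4) : R) = - (zeta8 * 'i%C).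
Proof.
have E : zeta8 * expi (- (pi / 4)) = 1 by rewrite -expiD subrr expi0.
exact: (root8_inv (sqr_iC R) zeta8_sqr E).
Qed.

(** omega3 is a cube root of unity, and it is not 1 because its imaginary part
    sin (2 pi / 3) is positive. *)
Lemma omega3_sqr : omega3 * omega3 = - omega3 - 1.
Proof.
apply: cube_root_eq; first by rewrite -!expiD -expi_2pi; congr expi; field.
rewrite subr_eq0; apply/eqP => /(congr1 (@complex.Im R)) /= /eqP.
rewrite gt_eqF //; apply: sin_gt0_pi.
have := pi_gt0 R; lra.
Qed.

Definition sqrtm (d : nat) : C := 0 +i* Num.sqrt d%:R.

Lemma sqrtm_sqr d : sqrtm d * sqrtm d = - d%:R.
Proof.
have dE : d%:R = (d%:R : R)%:C :> C by rewrite rmorph_nat.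
rewrite dE; apply/eqP; rewrite eq_complex /= !mul0r mulr0 add0r oppr0 addr0.
by rewrite -expr2 sqr_sqrtr ?ler0n // !eqxx.
Qed.

Lemma conjc_sqrtm d : conjc (sqrtm d) = - sqrtm d.
Proof. by apply/eqP; rewrite eq_complex /= oppr0 !eqxx. Qed.

Lemma half_sqrtm_sqr : sqrtm 2 / 2 * (sqrtm 2 / 2) = - 2^-1.
Proof. by rewrite mulrACA sqrtm_sqr; field. Qed.

End Constants.

(** * The groups generated by the third generators realize the presentations *)

Section Realizations.
Variable R : realType.
Local Notation C := R[i].
Local Notation M2 := 'M[R[i]]_2.
Local Notation iC2 := (sqr_iC R).
Local Notation two0 := (two_neq0C R).
Local Notation z2 := (zeta8_sqr R).
Local Notation w2 := (omega3_sqr R).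
Local Notation k2 := (half_sqrtm_sqr R).
Implicit Types (S : set C) (A K : set M2).

Definition HQ8_gen (n : nat) (g1 g2 : M2) : M2 :=
  HQ8_elt 'i%C (zeta8 R) (omega3 R) (sqrtm R 2 / 2) n g1 g2.

Arguments HQ8_gen : simpl never.
Arguments Q8_elt : simpl never.

Definition HQ8_gendet (n : nat) : C := HQ8_det 'i%C (omega3 R) n.

Section FixedPair.
Variables g1 g2 : M2.
Hypothesis rel : Q8_rel g1 g2.

Lemma HQ8_gen_act n : (1 <= n <= 9)%N ->
  HQ8_gen n g1 g2 * g1 = (HQ8_act n g1 g2).1 * HQ8_gen n g1 g2 /\
  HQ8_gen n g1 g2 * g2 = (HQ8_act n g1 g2).2 * HQ8_gen n g1 g2.
Proof. exact: (HQ8_elt_act _ _ _ iC2 two0 rel). Qed.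

Lemma HQ8_gen_det n : (1 <= n <= 9)%N -> \det (HQ8_gen n g1 g2) = HQ8_gendet n.
Proof. exact: (HQ8_elt_det iC2 two0 z2 w2 k2 rel). Qed.

Lemma HQ8_gen_pow n : (1 <= n <= 9)%N ->
  HQ8_gen n g1 g2 ^+ HQ8_index n = Q8_elt g1 g2 (HQ8_pow n).
Proof. exact: (HQ8_elt_pow iC2 two0 z2 w2 k2 rel). Qed.

Lemma HQ8_gendet_primitive n : (1 <= n <= 9)%N ->
  (HQ8_index n).-primitive_root (HQ8_gendet n).
Proof.
have three0 : 3 != 0 :> C by rewrite pnatr_eq0.
have w4 : omega3 R * omega3 R * (omega3 R * omega3 R) = - (omega3 R * omega3 R) - 1.
  by rewrite w2 mulrBl mulrBr mulNr !mulrN w2; ring.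
elim/nat_ind19; rewrite /HQ8_gendet /=;
  by [apply: prim_root2 two0 | apply: prim_root3 three0 w2 |
      apply: prim_root3 three0 w4 | apply: prim_root4 two0 iC2].
Qed.

Lemma HQ8_gen_unit n : (1 <= n <= 9)%N -> HQ8_gen n g1 g2 \is a GRing.unit.
Proof.
move=> n19; apply/GL2_full; split=> //; split=> //.
exists (HQ8_gendet n)^-1; split=> //.
rewrite HQ8_gen_det // mulfV //.
exact: prim_root_neq0 (HQ8_gendet_primitive n19).
Qed.

Lemma HQ8_gen_normalizes n : (1 <= n <= 9)%N -> normalizes_Q8 g1 g2 (HQ8_gen n g1 g2).
Proof.
move=> n19; have [E1 E2] := HQ8_gen_act n19.
suff [t1 [t2 [F1 F2]]] : exists t1 t2, (HQ8_act n g1 g2).1 = Q8_elt g1 g2 t1 /\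
    (HQ8_act n g1 g2).2 = Q8_elt g1 g2 t2.
  by exists t1, t2; rewrite E1 E2 F1 F2.
have [w1 w1N w2 w2N w3] := Q8_elt_words g1 g2.
by move: n19 {E1 E2}; elim/nat_ind19 => /=;
  [exists (false, true, false), (false, false, true)
  |exists (true, true, false), (true, false, true)
  |exists (false, false, true), (true, true, false)
  |exists (false, false, true), (false, true, false)
  |exists (false, true, false), (false, false, true)
  |exists (false, false, true), (false, true, true)
  |exists (true, true, false), (true, false, true)
  |exists (false, false, true), (false, true, false)
  |exists (false, false, true), (true, true, false)].
Qed.

Lemma HQ8_gen_generated n : (1 <= n <= 9)%N ->
  mx_generated [set g1; g2; HQ8_gen n g1 g2] =
  range (@ext_elt R g1 g2 (HQ8_gen n g1 g2) (HQ8_index n)).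
Proof.
move=> n19; apply: mx_generated_ext => //; first exact: HQ8_gen_unit.
- exact: HQ8_gen_normalizes.
- by rewrite HQ8_gen_det //; apply: HQ8_gendet_primitive.
- by exists (HQ8_pow n); apply: HQ8_gen_pow.
Qed.

Lemma omega3_exp_mod n : omega3 R ^+ (n %% 3) = omega3 R ^+ n.
Proof.
by apply: expr_mod; apply: prim_expr_order; apply: prim_root3 w2; rewrite pnatr_eq0.
Qed.

Lemma gen5_exp n : HQ8_gen 5 g1 g2 ^+ n = (omega3 R ^+ n)%:M.
Proof.
rewrite /HQ8_gen /= quat_scalar; elim: n => [|n IHn]; first by rewrite !expr0.
by rewrite !exprS IHn -mulmxE -scalar_mxM.
Qed.

(** Both sides are parametrized by pairs (k, t), which stand for omega3^k times
    the t-th element of Q. *)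
Lemma mul_isoQ8C3 : iso_Q8_C3 (mx_generated [set g1; g2; HQ8_gen 5 g1 g2]).
Proof.
rewrite /iso_Q8_C3 HQ8_gen_generated //=.
have [p [p_inj p_range pM]] := quaternion8_param.
pose q (k : 'I_3 * (bool * bool * bool)) : 'Q_8 * 'Z_3 := (p k.2, k.1).
have -> : [set: 'Q_8 * 'Z_3] = range q.
  apply/seteqP; split=> // -[x k] _.
  have : [set: 'Q_8] x by []. 
  by rewrite -p_range => -[t _ <-]; exists (k, t).
pose op (a b : 'I_3 * (bool * bool * bool)) : 'I_3 * (bool * bool * bool) :=
  ((a.1 : 'Z_3) + b.1, q8_op a.2 b.2).
apply: (mul_iso_param (ord0, (false, false, false)) (op := op)).
- apply: (ext_elt_inj rel); first exact: (@HQ8_gen_unit 5).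
  by rewrite HQ8_gen_det //; apply: (@HQ8_gendet_primitive 5).
- by move=> [k t] [l u] [/p_inj -> ->].
- move=> [k t] [l u]; rewrite /ext_elt /= !gen5_exp omega3_exp_mod.
  rewrite (Q8_elt_mul iC2 two0 rel) exprD scalar_mxM mulmxE.
  rewrite -!mulrA; congr (_ * _); rewrite !mulrA; congr (_ * _).
  exact: scalar_mxC.
- by move=> [k t] [l u]; rewrite /q /= pM.
Qed.

Lemma mx_generated_gen5 :
  mx_generated [set HQ8_gen 5 g1 g2] = range (fun n => (omega3 R ^+ n)%:M).
Proof.
have hu : [set HQ8_gen 5 g1 g2] `<=` GL2 [set: C].
  by move=> _ ->; apply/GL2_full; apply: HQ8_gen_unit.
have w3 : omega3 R ^+ 3 = 1 by rewrite -omega3_exp_mod.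
apply/seteqP; split.
- apply: mx_generated_min; first split.
  + move=> _ [n _ <-]; rewrite -gen5_exp; apply/GL2_full.
    by rewrite unitrX // HQ8_gen_unit.
  + by exists 0%N.
  + by move=> _ _ [m _ <-] [n _ <-]; exists (m + n)%N; rewrite // exprD scalar_mxM mulmxE.
  + move=> _ [n _ <-]; exists (2 * n)%N => //.
    have E : (omega3 R ^+ n)%:M * (omega3 R ^+ (2 * n))%:M = 1 :> M2.
      by rewrite -mulmxE -scalar_mxM -exprD -mulSn exprM w3 expr1n.
    have [xu _] := mulmx1_unit E.
    by rewrite -[LHS](mulKr xu) E mulr1.
  + by move=> _ ->; exists 1%N; rewrite // -gen5_exp expr1.
- have [_ G1 GM _] := mx_generated_subgroup hu.
  move=> _ [n _ <-]; rewrite -gen5_exp.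
  elim: n => [|n IHn]; rewrite ?expr0 // exprS; apply: GM => //.
  exact: sub_mx_generated.
Qed.

Lemma product_Q8C3 : internal_direct_product
  (mx_generated [set g1; g2; HQ8_gen 5 g1 g2])
  (mx_generated [set g1; g2]) (mx_generated [set HQ8_gen 5 g1 g2]).
Proof.
rewrite mx_generated_gen5 HQ8_gen_generated // (mx_generated_Q8 rel); split.
- apply/seteqP; split=> [_ [[k t] _ <-] | x [_ [_ [[t _ <-] [n _ <-] ->]]]].
    rewrite /ext_elt gen5_exp /=.
    by exists (Q8_elt g1 g2 t), (omega3 R ^+ k)%:M; split=> //; [exists t | exists (nat_of_ord k)].
  exists (Ordinal (ltn_pmod n (isT : 0 < 3)%N), t) => //.
  by rewrite /ext_elt gen5_exp /= omega3_exp_mod.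
- apply/seteqP; split=> [x [[t _ <-] [n _]] | _ ->]; last first.
    by split; [exists (false, false, false); rewrite // Q8_elt_1 | exists 0%N].
  move=> E; have := congr1 (@determinant _ _) E.
  rewrite (det_Q8_elt iC2 two0 rel) det_scalar -exprM -omega3_exp_mod => wn.
  rewrite -E -omega3_exp_mod; suff -> : (n %% 3 = 0)%N by rewrite expr0.
  have := HQ8_gendet_primitive (isT : 1 <= 6 <= 9)%N.
  rewrite /HQ8_gendet /= => /eq_prim_root_expr => /(_ (n * 2 %% 3)%N 0%N).
  rewrite wn expr0 eqxx mod0n => /esym/eqP; lia.
- by move=> _ _ [t _ <-] [n _ <-]; rewrite -mulmxE scalar_mxC.
Qed.

Lemma HQ8_gen_relations n : (1 <= n <= 9)%N ->
  HQ8_relations n (mx_generated [set g1; g2; HQ8_gen n g1 g2]) g1 g2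
    (HQ8_gen n g1 g2).
Proof.
move=> n19; have hu := HQ8_gen_unit n19.
have [E1 E2] := HQ8_gen_act n19; have Ed := HQ8_gen_det n19; have Ep := HQ8_gen_pow n19.
have conj x y : HQ8_gen n g1 g2 * x = y * HQ8_gen n g1 g2 ->
    HQ8_gen n g1 g2 * x * (HQ8_gen n g1 g2)^-1 = y.
  by move=> ->; rewrite mulrK.
move/conj: E1 => E1; move/conj: E2 => E2.
have [qp qm] : Q8_elt g1 g2 (false, false, false) = 1 /\ Q8_elt g1 g2 (true, false, false) = -1.
  by rewrite /Q8_elt !expr0 expr1 mulr1 scale1r scaleN1r.
have tr := tr_quat iC2 two0 rel.
have ev a b : a + b = \tr (HQ8_gen n g1 g2) -> a * b = HQ8_gendet n ->
    eigenvalues (HQ8_gen n g1 g2) a b.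
  by rewrite -Ed => sum prod; apply/char_poly_mx2.
clear hu conj Ed; move: n19 E1 E2 Ep ev; elim/nat_ind19;
  rewrite /HQ8_gen /HQ8_gendet /= ?tr => E1 E2; rewrite ?qp ?qm => Ep ev.
- by rewrite quat_scalar.
- by split=> //; apply: ev; rewrite ?mulr0 ?mulr1 // addNr.
- split=> //.
  + by rewrite -[4%N]/(2 * 2)%N exprM Ep expr2 -(Q8_elt_mul iC2 two0 rel).
  + by apply: ev; rewrite expi_3pi4 -/(zeta8 R);
      [rewrite mulrCA divff // mulr1; ring | rewrite mulrA z2 iC2].
  + right; rewrite Ep /Q8_elt expr1 scaleN1r.
    by rewrite !expr1.
- by split=> //; apply: ev; rewrite ?mulr0 ?mulr1 // addNr.
- by split; [rewrite quat_scalar | exact: product_Q8C3 | exact: mul_isoQ8C3].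
- split=> //; apply: ev; rewrite -/(omega3 R) ?mulr1 //.
  by rewrite mulrN mulrCA divff // mulr1 w2; ring.
- split=> //; apply: ev; rewrite expi_3pi4 expi_Npi4 ?mulr0 ?subrr //.
  by rewrite mulrN mulrACA z2 iC2 mulrN1 opprK.
- split=> //; apply: ev; rewrite expi_3pi4 expi_Npi4 ?mulr0 ?subrr //.
  by rewrite mulrN mulrACA z2 iC2 mulrN1 opprK.
- split=> //; apply: ev; rewrite ?mulr1 //.
  by rewrite mulrCA divff // mulr1 addrC.
Qed.

(** The only arithmetic input is that the three generators have entries in S;
    order and intersection with SL(2, S) are read off from the determinants. *)
Lemma HQ8_gen_is_HQ8 S n : (1 <= n <= 9)%N -> is_subring S ->
  SL2 S g1 -> SL2 S g2 -> GL2 S (HQ8_gen n g1 g2) ->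
  is_HQ8 S n (mx_generated [set g1; g2; HQ8_gen n g1 g2]).
Proof.
move=> n19 Sr Sg1 Sg2 Sh.
have detP : (HQ8_index n).-primitive_root (\det (HQ8_gen n g1 g2)).
  by rewrite HQ8_gen_det //; apply: HQ8_gendet_primitive.
have hu := HQ8_gen_unit n19; have hN := HQ8_gen_normalizes n19.
have hP : exists t, HQ8_gen n g1 g2 ^+ HQ8_index n = Q8_elt g1 g2 t.
  by exists (HQ8_pow n); apply: HQ8_gen_pow.
have KS : mx_generated [set g1; g2; HQ8_gen n g1 g2] `<=` GL2 S.
  apply: mx_generated_min; first exact: GL2_subgroup.
  by move=> x [[] | ] -> //; [case: Sg1 | case: Sg2].
have gens : [set g1; g2; HQ8_gen n g1 g2] `<=` GL2 [set: C].
  by move=> x [/(Q8_rel_GL2 rel) // | ->]; apply/GL2_full.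
have [_ K1 KM KV] := mx_generated_subgroup gens.
split; [by split | split].
- have := card_mx_generated_ext rel hu hN detP hP.
  by congr (_ #= `I__); move: n19 {Sh KS hN hP hu detP}; elim/nat_ind19.
exists g1, g2, (HQ8_gen n g1 g2); split=> //; split=> //.
- exact: (mx_generated_ext_SL rel hu hN detP hP Sr KS).
- exact: Q8_rel_generators.
- exact: HQ8_gen_relations.
Qed.

End FixedPair.
End Realizations.

(** * Uniqueness of the realizations up to conjugation *)

Section Uniqueness.
Variable R : realType.
Local Notation C := R[i].
Local Notation M2 := 'M[R[i]]_2.
Local Notation iC2 := (sqr_iC R).
Local Notation two0 := (two_neq0C R).
Implicit Types (S : set C) (A K : set M2).

Lemma Q8_rel_conj (g1 g2 k1 k2 : M2) : Q8_rel g1 g2 -> Q8_rel k1 k2 ->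
  exists2 P : M2, P \is a GRing.unit & P * g1 = k1 * P /\ P * g2 = k2 * P.
Proof.
move=> relg relk; have [P Pu [P1 P2]] := Q8_rel_conj_std iC2 two0 relg.
have [P' Pu' [P1' P2']] := Q8_rel_conj_std iC2 two0 relk.
have conj (x y z : M2) : P * x = z * P -> P' * y = z * P' ->
    P'^-1 * P * x = y * (P'^-1 * P).
  move=> Px Py; rewrite -mulrA Px; apply: (mulrI Pu').
  by rewrite mulVKr // mulrA Py -mulrA mulVKr.
exists (P'^-1 * P); first by rewrite unitrMl // unitrV.
by split; [apply: conj P1 P1' | apply: conj P2 P2'].
Qed.

(** The third generator is given by the same coordinates over every pair. *)
Lemma HQ8_gen_conj n (P g1 g2 k1 k2 : M2) : (1 <= n <= 9)%N ->
  P * g1 = k1 * P -> P * g2 = k2 * P -> P * HQ8_gen n g1 g2 = HQ8_gen n k1 k2 * P.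
Proof.
by move=> n19 P1 P2; move: n19; elim/nat_ind19; apply: quat_conj.
Qed.

Lemma mul_iso_HQ8_gen n (g1 g2 k1 k2 : M2) : (1 <= n <= 9)%N ->
  Q8_rel g1 g2 -> Q8_rel k1 k2 ->
  mul_iso *%R *%R (mx_generated [set g1; g2; HQ8_gen n g1 g2])
                  (mx_generated [set k1; k2; HQ8_gen n k1 k2]).
Proof.
move=> n19 relg relk; have [P Pu [P1 P2]] := Q8_rel_conj relg relk.
have Ph := HQ8_gen_conj n19 P1 P2.
have PX (x y : M2) m : P * x = y * P -> P * x ^+ m = y ^+ m * P.
  move=> Px; elim: m => [|m IHm]; first by rewrite !expr0 mulr1 mul1r.
  by rewrite !exprS mulrA Px -mulrA IHm mulrA.
have PM (x y x' y' : M2) : P * x = y * P -> P * x' = y' * P -> P * (x * x') = y * y' * P.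
  by move=> Px Px'; rewrite mulrA Px -!mulrA Px'.
have Pelt t : P * Q8_elt g1 g2 t = Q8_elt k1 k2 t * P.
  case: t => -[s b] c; rewrite /Q8_elt -scalerAr -scalerAl; congr (_ *: _).
  by apply: PM; apply: PX.
have Pext p : P * @ext_elt R g1 g2 (HQ8_gen n g1 g2) (HQ8_index n) p * P^-1 =
    ext_elt k1 k2 (HQ8_gen n k1 k2) p.
  by rewrite (PM _ _ _ _ (Pelt _) (PX _ _ _ Ph)) mulrK.
rewrite (HQ8_gen_generated relg n19) (HQ8_gen_generated relk n19).
exists (fun x => P * x * P^-1); split; first split.
- by move=> _ [p _ <-]; exists p; rewrite // Pext.
- by move=> x y _ _ /(mulIr _)-/(_ _)/(mulrI Pu); apply; rewrite unitrV.
- by move=> _ [p _ <-]; exists (ext_elt g1 g2 (HQ8_gen n g1 g2) p); [exists p | rewrite Pext].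
- by move=> x y _ _; rewrite !mulrA mulrVK.
Qed.

Lemma mx_generated_opp (g1 g2 h : M2) : Q8_rel g1 g2 -> h \is a GRing.unit ->
  mx_generated [set g1; g2; - h] = mx_generated [set g1; g2; h].
Proof.
move=> rel; have sub (x : M2) : x \is a GRing.unit ->
    mx_generated [set g1; g2; - x] `<=` mx_generated [set g1; g2; x].
  move=> xu; have gens : [set g1; g2; x] `<=` GL2 [set: C].
    by move=> y [/(Q8_rel_GL2 rel) // | ->]; apply/GL2_full.
  have Gg := mx_generated_subgroup gens; have [_ _ GM _] := Gg.
  apply: mx_generated_min => // y [[] ->| ->]; try by apply: sub_mx_generated; left; [left | right].
  - by apply: sub_mx_generated; left; left.
  - by apply: sub_mx_generated; left; right.
  - rewrite -mulN1r; case: (rel) => <- _ _; apply: (GM); last by apply: sub_mx_generated; right.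
    by apply: GM; apply: sub_mx_generated; left; left.
move=> hu; apply/seteqP; split; first exact: sub.
by rewrite -{1}[h]opprK; apply: sub; rewrite unitrN.
Qed.

(** The quotient of h and u commutes with g1 and g2, so it is a scalar c, and
    the determinants give c^2 = 1. *)
Lemma same_action_sign (g1 g2 h u a1 a2 : M2) : Q8_rel g1 g2 ->
  h * g1 = a1 * h -> h * g2 = a2 * h -> u * g1 = a1 * u -> u * g2 = a2 * u ->
  u \is a GRing.unit -> \det h = \det u -> h = u \/ h = - u.
Proof.
move=> rel h1 h2 u1 u2 uu hd.
have comm g a : h * g = a * h -> u * g = a * u -> u^-1 * h * g = g * (u^-1 * h).
  move=> hg ug; rewrite -mulrA hg; apply: (mulrI uu).
  by rewrite mulVKr // mulrA ug -mulrA mulVKr.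
have [c kc] := quat_centre iC2 two0 rel (comm _ _ h1 u1) (comm _ _ h2 u2).
have hE : h = c *: u.
  by rewrite -[LHS](mulVKr uu) kc -mulmxE mul_mx_scalar.
have du : \det u != 0.
  by have /GL2_full[_ [_ [v [_ uv]]]] := uu;
     apply: contra_eq_neq uv => ->; rewrite mul0r eq_sym oner_eq0.
move: hd; rewrite hE detZ -[RHS]mul1r => /(mulIf du)/eqP.
rewrite -subr_eq0 subr_sqr_1 mulf_eq0 subr_eq0 addr_eq0 => /orP[] /eqP ->.
  by left; rewrite scale1r.
by right; rewrite scaleN1r.
Qed.

(** The determinant is the product of the prescribed eigenvalues, or the square
    of the prescribed scalar. *)
Lemma HQ8_relations_act n K (g1 g2 h : M2) : (1 <= n <= 9)%N ->
  h \is a GRing.unit -> HQ8_relations n K g1 g2 h ->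
  [/\ h * g1 = (HQ8_act n g1 g2).1 * h, h * g2 = (HQ8_act n g1 g2).2 * h &
      \det h = HQ8_gendet R n].
Proof.
move=> n19 hu.
have conj (x y : M2) : h * x * h^-1 = y -> h * x = y * h.
  by move=> <-; rewrite mulrVK.
have ev a b : eigenvalues h a b -> \det h = a * b by move=> /char_poly_mx2[].
have z2 := zeta8_sqr R.
have d7 : zeta8 R * 'i%C * - (zeta8 R * 'i%C) = 'i%C.
  by rewrite mulrN mulrACA z2 iC2 mulrN1 opprK.
move: n19; elim/nat_ind19; rewrite /HQ8_gendet /=.
- move=> ->; rewrite det_scalar expr2 iC2 -!mulmxE.
  by split=> //; rewrite scalar_mxC.
- by case=> _ /conj-> /conj-> /ev ->; rewrite mulr1.
- by case=> _ /conj-> /conj-> /ev -> _; rewrite expi_3pi4 -/(zeta8 R) mulrA z2 iC2.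
- by case=> _ /conj-> /conj-> /ev ->; rewrite mulr1.
- case=> -> _ _; rewrite det_scalar expr2 -!mulmxE.
  by split=> //; rewrite scalar_mxC.
- by case=> _ /conj-> /conj-> /ev ->; rewrite mulr1.
- by case=> _ /conj-> /conj-> /ev ->; rewrite expi_3pi4 expi_Npi4.
- by case=> _ /conj-> /conj-> /ev ->; rewrite expi_3pi4 expi_Npi4.
- by case=> _ /conj-> /conj-> /ev ->; rewrite mulr1.
Qed.

Lemma is_HQ8_normal_form S n K : (1 <= n <= 9)%N -> is_HQ8 S n K ->
  exists g1 g2, Q8_rel g1 g2 /\ K = mx_generated [set g1; g2; HQ8_gen n g1 g2].
Proof.
move=> n19 [_ [_ [g1 [g2 [h [[_ _ Sh] [-> _ /Q8_generators_rel rel hrel]]]]]]].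
have hu : h \is a GRing.unit.
  by case: Sh => _ [_ [v [_ hv]]]; apply/GL2_full; split=> //; split=> //; exists v.
have [h1 h2 hd] := HQ8_relations_act n19 hu hrel.
have [u1 u2] := HQ8_gen_act rel n19; have uu := HQ8_gen_unit rel n19.
have hdu : \det h = \det (HQ8_gen n g1 g2) by rewrite hd HQ8_gen_det.
exists g1, g2; split=> //.
by have [-> // | ->] := same_action_sign rel h1 h2 u1 u2 uu hdu; rewrite mx_generated_opp.
Qed.

Lemma is_HQ8_unique S S' n K K' : (1 <= n <= 9)%N ->
  is_HQ8 S n K -> is_HQ8 S' n K' -> mul_iso *%R *%R K K'.
Proof.
move=> n19 /(is_HQ8_normal_form n19)[g1 [g2 [relg ->]]].
move=> /(is_HQ8_normal_form n19)[k1 [k2 [relk ->]]].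
exact: mul_iso_HQ8_gen.
Qed.

End Uniqueness.

(** * Integrality of traces and norms in quadratic orders *)

Section QuadraticOrders.
Variable R : realType.
Local Notation C := R[i].
Local Notation iC2 := (sqr_iC R).
Local Notation two0 := (two_neq0C R).
Implicit Types (S : set C).

Definition is_int (x : C) : Prop := exists m : int, x = m%:~R.

(** Trace and norm are expressed through complex conjugation, so the condition
    also makes sense for rational integers. *)
Definition integral_ring S : Prop :=
  is_subring S /\ forall x, S x -> is_int (x + conjc x) /\ is_int (x * conjc x).

Definition adjoin (t : C) : set C := [set x | exists m n : int, x = m%:~R + n%:~R * t].

Lemma conjc_int (m : int) : conjc (m%:~R : C) = m%:~R.
Proof. exact: rmorph_int. Qed.

Lemma adjoin_sub S t : is_subring S -> S t -> adjoin t `<=` S.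
Proof.
move=> Sr St _ [m [n ->]]; apply: subringD => //; first exact: subring_int.
by apply: subringM => //; apply: subring_int.
Qed.

(** The traces of x and t x together with the conjugates of t recover x by
    linear algebra, a priori with denominators; the integrality of the norm of
    x is what removes them. *)
Lemma adjoin_eq S t : integral_ring S -> S t ->
  (forall x, is_int (x + conjc x) -> is_int (t * x + conjc (t * x)) ->
     is_int (x * conjc x) -> adjoin t x) ->
  S = adjoin t.
Proof.
move=> [Sr Sint] St H; apply/seteqP; split; last exact: adjoin_sub.
move=> x Sx; have [trx nx] := Sint x Sx.
by have [trtx _] := Sint _ (subringM Sr St Sx); apply: H.
Qed.

Lemma gauss_solve (F : fieldType) (i x y t u : F) :
  i * i = -1 -> x + y = t -> i * x + - i * y = u ->
  2 * x = t - u * i /\ 4 * (x * y) = t * t + u * u.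
Proof. by move=> i2 <- <-; split; ring: i2. Qed.

Lemma sqrtm2_solve (F : fieldType) (b x y t u : F) :
  b * b = - 2 -> x + y = t -> b * x + - b * y = u ->
  4 * x = 2 * t - u * b /\ 8 * (x * y) = 2 * (t * t) + u * u.
Proof. by move=> b2 <- <-; split; ring: b2. Qed.

Lemma omega_cube (F : fieldType) (w : F) : w * w = - w - 1 -> w * w * w = 1.
Proof. by move=> w2; ring: w2. Qed.

Lemma omega_solve (F : fieldType) (w x y t u : F) :
  w * w = - w - 1 -> x + y = t -> w * x + (- w - 1) * y = u ->
  3 * x = t - u - (2 * u + t) * w /\ 3 * (x * y) = t * t + t * u + u * u.
Proof. by move=> w2 <- <-; split; ring: w2. Qed.

Lemma sqr_dvd (p : nat) (x y : int) : prime p -> x * x = p%:Z * y ->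
  exists z, x = p%:Z * z.
Proof.
move=> p_pr E; have : (p %| absz (x * x)%R)%N by rewrite E abszM dvdn_mulr.
rewrite abszM Euclid_dvdM // orbb => px.
have : (p%:Z %| x)%Z by rewrite dvdzE.
by case/dvdzP => z ->; exists z; rewrite mulrC.
Qed.

Lemma sqr_even (x y : int) : x * x = 2 * y -> exists z : int, x = 2 * z.
Proof. exact: (@sqr_dvd 2). Qed.

Lemma sqr_dvd3 (x y : int) : x * x = 3 * y -> exists z : int, x = 3 * z.
Proof. exact: (@sqr_dvd 3). Qed.

Lemma double_inj_int (x y : int) : 2 * x = 2 * y -> x = y.
Proof. by apply: mulfI. Qed.

(** The square of t + u is even, hence t = u modulo 2; then t^2 is even too. *)
Lemma gauss_parity (t u m : int) : 4 * m = t * t + u * u ->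
  exists a b : int, t = 2 * a /\ u = 2 * b.
Proof.
move=> E; have [z zE] : exists z : int, t + u = 2 * z.
  apply: (@sqr_even _ (2 * m + t * u)).
  have -> : (t + u) * (t + u) = t * t + u * u + 2 * (t * u) by ring.
  by rewrite -E; ring.
have uE : u = 2 * z - t by rewrite -zE; ring.
have [a aE] : exists a : int, t = 2 * a.
  apply: (@sqr_even _ (m - z * z + z * t)).
  move: E; rewrite uE => E.
  apply: double_inj_int.
  have -> : 2 * (t * t) = (t * t + (2 * z - t) * (2 * z - t)) - 4 * (z * z - z * t) by ring.
  by rewrite -E; ring.
by exists a, (z - a); split=> //; rewrite uE aE; ring.
Qed.

Lemma sqrtm2_parity (t u m : int) : 8 * m = 2 * (t * t) + u * u ->
  exists a b : int, t = 2 * a /\ u = 4 * b.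
Proof.
move=> E; have [v vE] : exists v : int, u = 2 * v.
  apply: (@sqr_even _ (4 * m - t * t)).
  have -> : u * u = (2 * (t * t) + u * u) - 2 * (t * t) by ring.
  by rewrite -E; ring.
have {}E : 4 * m = t * t + 2 * (v * v).
  apply: double_inj_int; transitivity (2 * (t * t) + u * u); last by rewrite vE; ring.
  by rewrite -E; ring.
have [a aE] : exists a : int, t = 2 * a.
  apply: (@sqr_even _ (2 * m - v * v)).
  have -> : t * t = (t * t + 2 * (v * v)) - 2 * (v * v) by ring.
  by rewrite -E; ring.
have [b bE] : exists b : int, v = 2 * b.
  apply: (@sqr_even _ (m - a * a)); apply: double_inj_int.
  have -> : 2 * (v * v) = (t * t + 2 * (v * v)) - t * t by ring.
  by rewrite -E aE; ring.
by exists a, b; split=> //; rewrite vE bE; ring.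
Qed.

(** t^2 + t u + u^2 is the square of t - u modulo 3. *)
Lemma omega_dvd3 (t u m : int) : 3 * m = t * t + t * u + u * u ->
  exists z : int, t = u + 3 * z.
Proof.
move=> E; have [z zE] : exists z : int, t - u = 3 * z.
  apply: (@sqr_dvd3 _ (m - t * u)).
  have -> : (t - u) * (t - u) = (t * t + t * u + u * u) - 3 * (t * u) by ring.
  by rewrite -E; ring.
by exists z; rewrite -zE; ring.
Qed.

Lemma int_cast_inj : injective (fun m : int => m%:~R : C).
Proof. exact: intr_inj. Qed.

Lemma conjcM (x y : C) : conjc (x * y) = conjc x * conjc y.
Proof. exact: (rmorphM (@conjc R)). Qed.

Lemma conjc_i : conjc 'i%C = - 'i%C :> C.
Proof. by apply/eqP; rewrite eq_complex /= oppr0 !eqxx. Qed.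

Lemma conjc_omega3 : conjc (omega3 R) = - omega3 R - 1.
Proof.
have w2 := omega3_sqr R.
have wcw : omega3 R * conjc (omega3 R) = 1.
  rewrite /omega3 /expi /=; apply/eqP; rewrite eq_complex /=.
  rewrite mulrN opprK -!expr2 cos2Dsin2 eqxx /=.
  by rewrite mulrN [sin _ * _]mulrC addNr.
have -> : conjc (omega3 R) = omega3 R * omega3 R * omega3 R * conjc (omega3 R).
  by rewrite (omega_cube w2) mul1r.
by rewrite -mulrA wcw mulr1 w2.
Qed.

Lemma gauss_adjoin (x : C) : is_int (x + conjc x) ->
  is_int ('i%C * x + conjc ('i%C * x)) -> is_int (x * conjc x) -> adjoin 'i%C x.
Proof.
move=> [t tE] [u uE] [m mE]; rewrite conjcM conjc_i in uE.
have [xE nE] := gauss_solve iC2 tE uE; rewrite mE in nE.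
have [a [b [ta ub]]] : exists a b : int, t = 2 * a /\ u = 2 * b.
  by apply: (@gauss_parity _ _ m); apply: int_cast_inj; rewrite !(intrD, intrM).
exists a, (- b); apply: (mulfI two0); rewrite xE ta ub !intrM mulrNz mulrDr.
by rewrite mulrA; ring.
Qed.

Lemma sqrtm2_adjoin (x : C) : is_int (x + conjc x) ->
  is_int (sqrtm R 2 * x + conjc (sqrtm R 2 * x)) -> is_int (x * conjc x) ->
  adjoin (sqrtm R 2) x.
Proof.
move=> [t tE] [u uE] [m mE]; rewrite conjcM conjc_sqrtm in uE.
have [xE nE] := sqrtm2_solve (sqrtm_sqr R 2) tE uE; rewrite mE in nE.
have [a [b [ta ub]]] : exists a b : int, t = 2 * a /\ u = 4 * b.
  by apply: (@sqrtm2_parity _ _ m); apply: int_cast_inj; rewrite !(intrD, intrM).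
have four0 : 4 != 0 :> C by rewrite pnatr_eq0.
exists a, (- b); apply: (mulfI four0); rewrite xE ta ub !intrM mulrNz.
ring.
Qed.

Lemma omega3_adjoin (x : C) : is_int (x + conjc x) ->
  is_int (omega3 R * x + conjc (omega3 R * x)) -> is_int (x * conjc x) ->
  adjoin (omega3 R) x.
Proof.
move=> [t tE] [u uE] [m mE]; rewrite conjcM conjc_omega3 in uE.
have [xE nE] := omega_solve (omega3_sqr R) tE uE; rewrite mE in nE.
have [z tz] : exists z : int, t = u + 3 * z.
  by apply: (@omega_dvd3 _ _ m); apply: int_cast_inj; rewrite !(intrD, intrM).
have three0 : 3 != 0 :> C by rewrite pnatr_eq0.
exists z, (- (u + z)); apply: (mulfI three0); rewrite xE tz mulrNz !(intrM, intrD).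
ring.
Qed.

End QuadraticOrders.

Section EndomorphismRings.
Variable R : realType.
Local Notation C := R[i].
Implicit Types (S : set C).

Lemma vieta_solve (F : fieldType) (x y t n : F) : x - y != 0 ->
  x * x - t * x + n = 0 -> y * y - t * y + n = 0 -> x + y = t /\ x * y = n.
Proof.
move=> xy Ex Ey; have tE : x + y = t.
  apply/eqP; rewrite -subr_eq0; apply/eqP/(mulfI xy).
  have -> : (x - y) * (x + y - t) = (x * x - t * x + n) - (y * y - t * y + n) by ring.
  by rewrite Ex Ey subrr mulr0.
split=> //; apply/eqP; rewrite -subr_eq0 -oppr_eq0 -Ex -tE; apply/eqP; ring.
Qed.

Lemma eigen_solve (F : fieldType) (x u v a b c d : F) : u != 0 -> v != 0 ->
  x * u = a * u + b * v -> x * v = c * u + d * v ->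
  x * x - (a + d) * x + (a * d - b * c) = 0.
Proof.
move=> u0 v0 Eu Ev; apply: (mulfI (mulf_neq0 u0 v0)); rewrite mulr0.
have -> : u * v * (x * x - (a + d) * x + (a * d - b * c)) =
    (x * u) * (x * v) - d * v * (x * u) - a * u * (x * v) + (a * d - b * c) * u * v by ring.
by rewrite Eu Ev; ring.
Qed.

(** Multiplication by x on the period lattice is an integral 2 x 2 matrix with
    eigenvalue x.  If x is not real its conjugate is the other eigenvalue; if x
    is real, the independence of the periods makes it an integer. *)
Lemma elliptic_integral_ring S : is_elliptic_endomorphism_ring S -> integral_ring S.
Proof.
move=> [w1 [w2 [indep ->]]]; set L := period_lattice w1 w2; split.
  split=> [x Lx | x y Sx Sy z Lz | x y Sx Sy z Lz]; first by rewrite mul1r.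
    have [m [n E]] := Sx z Lz; have [m' [n' E']] := Sy z Lz.
    by exists (m - m'), (n - n'); rewrite mulrBl E E' !intrB; ring.
  by rewrite -mulrA; apply/Sx/Sy.
move=> x Sx.
have [a [b E1]] : L (x * w1) by apply: Sx; exists 1, 0; rewrite mul1r mul0r addr0.
have [c [d E2]] : L (x * w2) by apply: Sx; exists 0, 1; rewrite mul1r mul0r add0r.
have w10 : w1 != 0.
  apply/eqP => w10; have /indep[/eqP] : 1%:C * w1 + 0%:C * w2 = 0.
    by rewrite w10 mulr0 mul0r addr0.
  by rewrite oner_eq0.
have w20 : w2 != 0.
  apply/eqP => w20; have /indep[_ /eqP] : 0%:C * w1 + 1%:C * w2 = 0.
    by rewrite w20 mulr0 mul0r addr0.
  by rewrite oner_eq0.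
have [xr | xi] := eqVneq (complex.Im x) 0.
  have xE : x = (complex.Re x)%:C by case: x xr {Sx E1 E2} => p q /= ->.
  have /indep[/eqP] :
      (complex.Re x - a%:~R)%:C * w1 + (- b%:~R : R)%:C * w2 = 0.
    have ratC (m : int) : (m%:~R : R)%:C = m%:~R :> C by exact: rmorph_int.
    rewrite !rmorphB !rmorphN /= !ratC -xE mulrBl E1; ring.
  rewrite subr_eq0 => /eqP ra _.
  have xa : x = a%:~R by rewrite xE ra; apply: rmorph_int.
  by rewrite xa conjc_int; split; [exists (a + a); rewrite intrD | exists (a * a); rewrite intrM].
have xJ : x - conjc x != 0.
  apply: contra xi => /eqP/(congr1 (@complex.Im R)); case: (x) => p q /=.
  by rewrite opprK => /eqP; rewrite -mulr2n mulrn_eq0.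
have Ex := eigen_solve w10 w20 E1 E2.
have EJ : conjc x * conjc x - (a%:~R + d%:~R) * conjc x +
    (a%:~R * d%:~R - b%:~R * c%:~R) = 0.
  have := congr1 (@conjc R) Ex.
  have conjc0 : conjc (0 : C) = 0 by apply: rmorph0.
  have conjcD (u v : C) : conjc (u + v) = conjc u + conjc v by apply: rmorphD.
  have conjcN (u : C) : conjc (- u) = - conjc u by apply: rmorphN.
  by rewrite !(conjcD, conjcN, conjcM, conjc_int) conjc0.
have [-> ->] := vieta_solve xJ Ex EJ.
by split; [exists (a + d); rewrite intrD | exists (a * d - b * c); rewrite intrB !intrM].
Qed.

End EndomorphismRings.

Lemma quadratic_mul (F : fieldType) (b d p q p' q' : F) : b * b = - d ->
  (p + q * b) * (p' + q' * b) = p * p' - d * (q * q') + (p * q' + q * p') * b.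
Proof. by move=> b2; ring: b2. Qed.

Lemma quadratic_inv (F : fieldType) (b p q n z : F) : n != 0 -> z != 0 ->
  z * (p - q * b) = n -> z^-1 = p / n + (- q) / n * b.
Proof.
move=> n0 z0 zn; apply: (mulfI z0); rewrite divff //.
have -> : p / n + (- q) / n * b = (p - q * b) / n by ring.
by rewrite mulrA zn divff.
Qed.

Section GeneratedFields.
Variable R : realType.
Local Notation C := R[i].
Implicit Types (A S : set C).

Definition is_subfield S : Prop :=
  [/\ S 1, forall x y : C, S x -> S y -> S (x - y) &
      forall x y : C, S x -> S y -> S (x / y)].

Lemma divring_closedP S : GRing.divring_closed [in S] <-> is_subfield S.
Proof.
split=> [[S1 SB SM] | [S1 SB SM]]; split.
- by move: S1; rewrite !inE.
- by move=> x y Sx Sy; have := SB x y; rewrite !inE; apply.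
- by move=> x y Sx Sy; have := SM x y; rewrite !inE; apply.
- by rewrite !inE.
- by move=> x y; rewrite !inE; apply: SB.
- by move=> x y; rewrite !inE; apply: SM.
Qed.

Lemma generated_field_subfield A : is_subfield (generated_field A).
Proof.
split=> [K [/divring_closedP[K1 _ _] _] // | x y Fx Fy K KA | x y Fx Fy K KA];
  have [/divring_closedP[_ KB KM] _] := KA.
- by apply: KB; [apply: Fx | apply: Fy].
- by apply: KM; [apply: Fx | apply: Fy].
Qed.

Lemma sub_generated_field A : A `<=` generated_field A.
Proof. by move=> x Ax K [_ AK]; apply: AK. Qed.

Lemma generated_field_min A S : is_subfield S -> A `<=` S -> generated_field A `<=` S.
Proof. by move=> /divring_closedP Sf AS x; apply. Qed.

Lemma subfield_subring S : is_subfield S -> is_subring S.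
Proof.
case=> S1 SB SV; split=> // x y Sx Sy.
have -> : x * y = x / (1 / y) by rewrite div1r invrK.
by apply: (SV) => //; apply: SV.
Qed.

Lemma subfield_GL2 S (x : 'M[R[i]]_2) : is_subfield S ->
  (forall i j, S (x i j)) -> \det x != 0 -> GL2 S x.
Proof.
move=> Sf Sx x0; have Sr := subfield_subring Sf; split=> //.
have Sd : S (\det x).
  rewrite det_mx2; case: (Sr) => _ SB SM.
  by apply: (SB); apply: (SM).
split=> //; exists (\det x)^-1; rewrite mulfV //; split=> //.
by rewrite -div1r; case: Sf => S1 _ SV; apply: SV.
Qed.

(** The numbers p + q sqrt(-d) with p, q rational already form a field. *)
Lemma quadratic_field_coords d x : (0 < d)%N -> quadratic_field d x ->
  exists p q : rat, x = ratr p + ratr q * sqrtm R d.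
Proof.
move=> d_gt0; pose K := [set x : C | exists p q : rat, x = ratr p + ratr q * sqrtm R d].
apply: (@generated_field_min _ K); last first.
  by move=> _ ->; exists 0, 1; rewrite rmorph0 rmorph1 add0r mul1r.
have KM (y z : C) : K y -> K z -> K (y * z).
  move=> [p [q ->]] [p' [q' ->]].
  exists (p * p' - d%:R * (q * q')), (p * q' + q * p').
  rewrite rmorphB !rmorphD !rmorphM /= rmorph_nat.
  exact: (quadratic_mul _ _ _ _ (sqrtm_sqr R d)).
split=> [|_ _ [p [q ->]] [p' [q' ->]] | y z Ky [p [q zE]]].
- by exists 1, 0; rewrite rmorph0 rmorph1 mul0r addr0.
- by exists (p - p'), (q - q'); rewrite !rmorphB; ring.
apply: KM => //; pose n : rat := p * p + d%:R * (q * q).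
have [z0 | z0] := eqVneq z 0.
  by rewrite z0 invr0; exists 0, 0; rewrite rmorph0 mul0r addr0.
have nE : z * (ratr p - ratr q * sqrtm R d) = ratr n :> C.
  rewrite zE /n rmorphD !rmorphM /= rmorph_nat.
  have -> : (ratr p + ratr q * sqrtm R d) * (ratr p - ratr q * sqrtm R d) =
    ratr p * ratr p - ratr q * ratr q * (sqrtm R d * sqrtm R d) :> C by ring.
  by rewrite sqrtm_sqr; ring.
have n0 : n != 0.
  have d0 : d%:R != 0 :> rat by rewrite pnatr_eq0 -lt0n.
  have q_ge0 : 0 <= d%:R * q ^+ 2 :> rat by rewrite mulr_ge0 ?ler0n ?sqr_ge0.
  rewrite /n -!expr2 paddr_eq0 ?sqr_ge0 // [d%:R * _ == 0]mulf_eq0 (negPf d0) !sqrf_eq0.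
  apply: contra z0 => /andP[/eqP p0 /eqP q0].
  by rewrite zE p0 q0 rmorph0 mul0r addr0.
exists (p / n), (- q / n).
rewrite !rmorphM !fmorphV rmorphN.
by apply: quadratic_inv nE; rewrite ?fmorph_eq0.
Qed.

(** Gauss's lemma: the factor X - q of a monic integral polynomial is a rational
    multiple of an integral polynomial whose leading coefficient is a unit. *)
Lemma integral_rat (q : rat) : integralOver (intr : int -> C) (ratr q) ->
  is_int (ratr q : C).
Proof.
move=> [p p_monic]; have -> : map_poly (intr : int -> C) p =
    map_poly ratr (map_poly (intr : int -> rat) p).
  by rewrite -map_poly_comp; apply: eq_map_poly => m /=; rewrite ratr_int.
rewrite fmorph_root => /factor_theorem[r pE].
have : ('X - q%:P) %| map_poly (intr : int -> rat) p by rewrite pE dvdp_mulIr.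
case/dvdpP_rat_int => p1 [a a0 qE] [r1 p_eq].
have lead1 : lead_coef p1 * lead_coef r1 = 1.
  by rewrite -lead_coefM -p_eq; apply/eqP.
have al : a * (lead_coef p1)%:~R = 1.
  have := congr1 lead_coef qE.
  rewrite lead_coefXsubC lead_coefZ lead_coef_map_inj; [by move=> <- | exact: intr_inj | by []].
have aE : a = (lead_coef r1)%:~R.
  have one : 1 = (lead_coef p1)%:~R * (lead_coef r1)%:~R :> rat.
    by rewrite -intrM lead1.
  by have := congr1 ( *%R a) one; rewrite mulr1 mulrA al mul1r.
have qE0 : q = - (lead_coef r1 * p1`_0)%:~R.
  have := congr1 (fun u : {poly rat} => u`_0) qE.
  rewrite coefB coefX coefC coefZ coef_map aE /= sub0r => /(canRL (@opprK _)) ->.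
  by rewrite intrM.
by exists (- (lead_coef r1 * p1`_0)); rewrite qE0 -mulrNz ratr_int.
Qed.

Lemma integral_conjc x : integralOver (intr : int -> C) x ->
  integralOver (intr : int -> C) (conjc x).
Proof.
move=> [p p_monic px]; exists p => //.
have -> : map_poly (intr : int -> C) p = map_poly (@conjc R) (map_poly intr p).
  by rewrite -map_poly_comp; apply: eq_map_poly => m /=; rewrite conjc_int.
by rewrite fmorph_root.
Qed.

(** Trace and norm of an integral element are integral and rational. *)
Lemma quadratic_integers_integral_ring d : (0 < d)%N ->
  integral_ring (quadratic_integers d : set C).
Proof.
move=> d_gt0; have Fr := subfield_subring (generated_field_subfield [set sqrtm R d]).
have [F1 FB FM] := Fr; split.
  split=> [|x y [Fx ix] [Fy iy] | x y [Fx ix] [Fy iy]].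
  - by split=> //; apply: integral1.
  - by split; [apply: FB | apply: integral_sub].
  - by split; [apply: FM | apply: integral_mul].
move=> x [Fx ix]; have iJ := integral_conjc ix.
have [p [q xE]] := quadratic_field_coords d_gt0 Fx.
have conjE : conjc x = ratr p - ratr q * sqrtm R d.
  rewrite xE; transitivity (conjc (ratr p) + conjc (ratr q) * conjc (sqrtm R d) : C).
    by rewrite -conjcM; apply: (rmorphD (@conjc R)).
  have ratJ (u : rat) : conjc (ratr u : C) = ratr u by apply: (fmorph_rat (@conjc R)).
  by rewrite !ratJ conjc_sqrtm mulrN.
have trE : x + conjc x = ratr (p + p).
  by rewrite conjE xE rmorphD; ring.
have nE : x * conjc x = ratr (p * p + d%:R * (q * q)).
  rewrite conjE xE -mulNr (quadratic_mul _ _ _ _ (sqrtm_sqr R d)).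
  by rewrite rmorphD !rmorphM /= rmorph_nat; ring.
split; rewrite ?trE ?nE; apply: integral_rat; rewrite -?trE -?nE.
  exact: integral_add.
exact: integral_mul.
Qed.

End GeneratedFields.

Lemma omega_disc (F : fieldType) (w : F) : w * w = - w - 1 ->
  (2 * w + 1) * (2 * w + 1) = - 3.
Proof. by move=> w2; ring: w2. Qed.

Lemma omega_norm (F : fieldType) (w : F) : w * w = - w - 1 ->
  w * w + w * w * (w * w) = -1.
Proof. by move=> w2; ring: w2. Qed.

Lemma root8_sqr (F : fieldType) (i z : F) : i * i = -1 -> z * z = i ->
  z * (1 + i) * (z * (1 + i)) = 2 * (i * i).
Proof. by move=> i2 z2; ring: i2 z2. Qed.

Lemma root8_eq (F : fieldType) (i z : F) : i * i = -1 -> 2 != 0 :> F ->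
  z = z * (1 + i) * (1 - i) / 2.
Proof. by move=> i2 two_neq0; field: i2. Qed.

(** * Explicit realizations *)

Section ExplicitRealizations.
Variable R : realType.
Local Notation C := R[i].
Local Notation M2 := 'M[R[i]]_2.
Local Notation iC2 := (sqr_iC R).
Local Notation two0 := (two_neq0C R).
Implicit Types (S : set C).

Lemma quat_entries S (g1 g2 : M2) (a b c d : C) : is_subring S ->
  (forall k l, S (g1 k l)) -> (forall k l, S (g2 k l)) ->
  S a -> S b -> S c -> S d -> forall k l, S (quat g1 g2 a b c d k l).
Proof.
move=> Sr S1 S2 Sa Sb Sc Sd k l; rewrite /quat -mulmxE !mxE sum_ord2.
do ?[apply: subringD => //]; apply: subringM => //.
  exact: subring_nat.
by apply: subringD => //; apply: subringM.
Qed.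

Lemma mx2_entries S (a b c d : C) : S a -> S b -> S c -> S d ->
  forall k l, S (mx2 a b c d k l).
Proof. by move=> Sa Sb Sc Sd; elim/ord2_cases; elim/ord2_cases; rewrite mxE. Qed.

Lemma SL2_entries S (x : M2) : S 1 -> (forall k l, S (x k l)) -> \det x = 1 -> SL2 S x.
Proof.
move=> S1 Sx dx; split=> //; split=> //; rewrite dx.
by split=> //; exists 1; rewrite mulr1.
Qed.

Lemma Q8_rel_det (g1 g2 : M2) : Q8_rel g1 g2 -> \det g1 = 1 /\ \det g2 = 1.
Proof.
move=> rel; have D := det_quat iC2 two0 rel.
have := (D 0 1 0 0, D 0 0 1 0); rewrite quat_g1 quat_g2 => -[-> ->].
by rewrite !expr0n !expr1n /= !addr0 !add0r.
Qed.

(** A quaternion pair over a field exists as soon as -1 is a sum of two squares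
    x^2 + y^2: 0 + i^2 for Z[i], w^2 + w^4 for a cube root of unity w, and
    1 + sqrt(-2)^2. *)
Lemma Q8_rel_anti (F : fieldType) (x y : F) : x * x + y * y = -1 ->
  Q8_rel (mx2 0 1 (-1) 0) (mx2 x y y (- x)).
Proof.
move=> xy; have xx : x * x = -1 - y * y by rewrite -xy addrK.
by split; rewrite !mx2_mul ?mx2_1 !mx2_opp; congr mx2; ring: xx.
Qed.

(** Over a subfield of C the entries are the only condition; the isomorphism
    with all complex realizations comes from the uniqueness over C. *)
Lemma subfield_realization S n (g1 g2 : M2) : is_subfield S -> (1 <= n <= 9)%N ->
  Q8_rel g1 g2 -> (forall k l, S (g1 k l)) -> (forall k l, S (g2 k l)) ->
  (forall k l, S (HQ8_gen n g1 g2 k l)) ->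
  exists Ho, mx_subgroup (GL2 S) Ho /\ isomorphic_to_HQ8 [set: C] n Ho.
Proof.
move=> Sf n19 rel S1 S2 Sh; have Sr := subfield_subring Sf.
have [d1 d2] := Q8_rel_det rel; have one : S 1 by case: Sr.
pose Ho := mx_generated [set g1; g2; HQ8_gen n g1 g2].
have hu := HQ8_gen_unit rel n19.
have hd : \det (HQ8_gen n g1 g2) != 0.
  have /GL2_full[_ [_ [v [_ uv]]]] := hu.
  by apply: contra_eq_neq uv => ->; rewrite mul0r eq_sym oner_eq0.
have [HoS _] : is_HQ8 S n Ho.
  by apply: HQ8_gen_is_HQ8; rewrite //;
    [apply: SL2_entries | apply: SL2_entries | apply: subfield_GL2].
have HoT : is_HQ8 [set: C] n Ho.
  apply: HQ8_gen_is_HQ8; rewrite //; [exact: SL2_entries | exact: SL2_entries | ].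
  exact/GL2_full.
exists Ho; split=> //; split; first by exists Ho.
by move=> K; apply: is_HQ8_unique n19 HoT.
Qed.

Lemma gaussian_subring : is_subring (@gaussian_integers R).
Proof.
split=> [|_ _ [a [b ->]] [c [d ->]] | _ _ [a [b ->]] [c [d ->]]].
- by exists 1, 0; rewrite mul0r addr0.
- by exists (a - c), (b - d); rewrite !intrB; ring.
- exists (a * c - b * d), (a * d + b * c).
  rewrite (quadratic_mul _ _ _ _ iC2) mul1r !(intrD, intrB, intrM).
  by rewrite mulrNz !intrM.
Qed.

Lemma gaussian_i : gaussian_integers ('i%C : C).
Proof. by exists 0, 1; rewrite add0r mul1r. Qed.

(** In the pair with matrices (0 1; -1 0) and (0 i; i 0) the third generators
    of index 1, 2, 9 are i, diag(-1, 1) and diag(i, 1). *)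
Lemma gaussian_realizations n : n \in [:: 1; 2; 9]%N ->
  exists K, is_HQ8 (@gaussian_integers R) n K.
Proof.
move=> nE; have n19 : (1 <= n <= 9)%N by move: nE; rewrite !inE => /or3P[] /eqP ->.
have Sr := gaussian_subring; have Si := gaussian_i.
have S0 : gaussian_integers (0 : C) := subring0 Sr.
have S1 : gaussian_integers (1 : C) by case: Sr.
have SN (x : C) : gaussian_integers x -> gaussian_integers (- x) by apply: subringN.
pose g1 : M2 := mx2 0 1 (-1) 0; pose g2 : M2 := mx2 0 'i%C 'i%C (- 0).
have rel : Q8_rel g1 g2 by apply: Q8_rel_anti; rewrite mul0r add0r iC2.
have [d1 d2] := Q8_rel_det rel.
have quatE (a b c d : C) : quat g1 g2 a b c d =
    mx2 (a + 'i%C * d) (b + 'i%C * c) (- b + 'i%C * c) (a - 'i%C * d).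
  rewrite /quat /g1 /g2 mx2_mul mx2_1 !mx2_scale !mx2_add.
  by congr mx2; rewrite ?(mulr0, mul0r, mulr1, mul1r, addr0, add0r, oppr0, mulrN, mulNr);
    rewrite // mulrC.
exists (mx_generated [set g1; g2; HQ8_gen n g1 g2]).
apply: HQ8_gen_is_HQ8 => //.
- by apply: SL2_entries d1 => //; apply: mx2_entries => //; apply: SN.
- by apply: SL2_entries d2 => //; apply: mx2_entries => //; apply: SN.
split; last first.
  rewrite HQ8_gen_det // /HQ8_gendet; move: nE; rewrite !inE => /or3P[] /eqP -> /=.
  + by split; [apply: SN | exists (-1); split; [apply: SN | rewrite mulrNN mulr1]].
  + by split; [apply: SN | exists (-1); split; [apply: SN | rewrite mulrNN mulr1]].
  + by split=> //; exists (- 'i%C); split; [apply: SN | rewrite mulrN iC2 opprK].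
move: nE; rewrite !inE => /or3P[] /eqP ->; rewrite /HQ8_gen /= quatE.
- by apply: mx2_entries; rewrite !mulr0 ?addr0 ?subr0 ?oppr0.
- by apply: mx2_entries; rewrite ?mulr0 ?add0r ?sub0r ?oppr0 ?addr0 ?iC2 ?opprK //; apply: SN.
- have ci : 'i%C * ((1 + 'i%C) / 2) = ('i%C - 1) / 2 :> C by rewrite mulrA mulrDr mulr1 iC2.
  have c1 : (1 + 'i%C) / 2 + ('i%C - 1) / 2 = 'i%C :> C by field.
  have c2 : (1 + 'i%C) / 2 - ('i%C - 1) / 2 = 1 :> C by field.
  by apply: mx2_entries; rewrite ?mulr0 ?oppr0 ?addr0 // ?ci ?c1 ?c2.
Qed.

Lemma sqr_eq_or (F : fieldType) (x y : F) : x * x = y * y -> x = y \/ x = - y.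
Proof.
move=> E; have /eqP : (x - y) * (x + y) = 0.
  have -> : (x - y) * (x + y) = x * x - y * y by ring.
  by rewrite E subrr.
by rewrite mulf_eq0 subr_eq0 addr_eq0 => /orP[] /eqP; [left | right].
Qed.

Lemma subfieldV S (x : C) : is_subfield S -> S x -> S x^-1.
Proof. by case=> S1 _ SV Sx; rewrite -div1r; apply: SV. Qed.

Lemma quadratic_field_sqrtm d : quadratic_field d (sqrtm R d).
Proof. exact: sub_generated_field. Qed.

(** 2 omega3 + 1 has square -3, so it is one of the two square roots of -3. *)
Lemma quadratic_field_omega3 : quadratic_field 3 (omega3 R).
Proof.
have Ff := generated_field_subfield [set sqrtm R 3]; have Fr := subfield_subring Ff.
have F1 : quadratic_field 3 (1 : C) by case: Ff.
have F3 := @quadratic_field_sqrtm 3.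
have [y Fy yE] : exists2 y : C, quadratic_field 3 y & 2 * omega3 R + 1 = y.
  have : (2 * omega3 R + 1) * (2 * omega3 R + 1) = sqrtm R 3 * sqrtm R 3.
    by rewrite sqrtm_sqr; exact: (omega_disc (omega3_sqr R)).
  case/sqr_eq_or => ->; [by exists (sqrtm R 3) | exists (- sqrtm R 3) => //].
  exact: subringN Fr F3.
have -> : omega3 R = (y - 1) / 2.
  by rewrite -yE addrK mulrC mulKf // two0.
exact: subringM Fr (subringD Fr Fy (subringN Fr F1)) (subfieldV Ff (subring_nat 2 Fr)).
Qed.

Lemma integral_quadratic (x : C) (a b : int) : x * x + a%:~R * x + b%:~R = 0 ->
  integralOver (intr : int -> C) x.
Proof.
move=> xE; exists ('X^2 + (a *: 'X + b%:P)).
  rewrite monicE lead_coefDl ?lead_coefXn // size_polyXn ltnS.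
  apply: leq_trans (size_polyD _ _) _; rewrite geq_max.
  rewrite (leq_trans (size_scale_leq _ _)) ?size_polyX //.
  by rewrite (leq_trans (size_polyC_leq1 _)).
rewrite /root !rmorphD /= map_polyXn map_polyZ /= map_polyX map_polyC /=.
by rewrite !hornerE; apply/eqP; apply: xE.
Qed.

Lemma quadratic_integers_omega3 : quadratic_integers 3 (omega3 R).
Proof.
split; first exact: quadratic_field_omega3.
by apply: (@integral_quadratic _ 1 1); rewrite omega3_sqr mulr1z; ring.
Qed.

Lemma quadratic_integers_sqrtm2 : quadratic_integers 2 (sqrtm R 2).
Proof.
split; first exact: quadratic_field_sqrtm.
by apply: (@integral_quadratic _ 0 2); rewrite sqrtm_sqr mulr0z mul0r addr0 addNr.
Qed.

Lemma Q8_rel_omega3 : Q8_rel (mx2 0 1 (-1) 0)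
  (mx2 (omega3 R) (omega3 R * omega3 R) (omega3 R * omega3 R) (- omega3 R)).
Proof. exact/Q8_rel_anti/(omega_norm (omega3_sqr R)). Qed.

Lemma quadratic_integers3_realization : exists K, is_HQ8 (@quadratic_integers R 3) 5 K.
Proof.
have [Sr _] := quadratic_integers_integral_ring R (isT : 0 < 3)%N.
have Sw := quadratic_integers_omega3.
have S1 : quadratic_integers 3 (1 : C) by case: Sr.
have S0 := subring0 Sr; have SN1 := subringN Sr S1.
have Sww := subringM Sr Sw Sw; have SNw := subringN Sr Sw.
have rel := Q8_rel_omega3; have [d1 d2] := Q8_rel_det rel.
have E1 : forall k l, quadratic_integers 3 ((mx2 0 1 (-1) 0 : M2) k l) by apply: mx2_entries.
have E2 : forall k l, quadratic_integers 3 ((mx2 (omega3 R) (omega3 R * omega3 R)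
  (omega3 R * omega3 R) (- omega3 R) : M2) k l) by apply: mx2_entries.
eexists; apply: (HQ8_gen_is_HQ8 (n := 5) rel) => //; try exact: SL2_entries.
split; first exact: (quat_entries Sr).
rewrite HQ8_gen_det //; split=> //; exists (omega3 R); split=> //.
exact: (omega_cube (omega3_sqr R)).
Qed.

Lemma sqrtm2_realization :
  exists Ho, mx_subgroup (GL2 (@quadratic_field R 2)) Ho /\ isomorphic_to_HQ8 [set: C] 4 Ho.
Proof.
have Ff := generated_field_subfield [set sqrtm R 2]; have Fr := subfield_subring Ff.
have Fb := @quadratic_field_sqrtm 2.
have F1 : quadratic_field 2 (1 : C) by case: Ff.
have F0 := subring0 Fr; have FN1 := subringN Fr F1.
have F2 := subfieldV Ff (subring_nat 2 Fr).
have rel : Q8_rel (mx2 0 1 (-1) 0) (mx2 1 (sqrtm R 2) (sqrtm R 2) (- 1)).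
  by apply: Q8_rel_anti; rewrite sqrtm_sqr mulr1; ring.
apply: (subfield_realization (n := 4) Ff isT rel); try by apply: mx2_entries.
have Fh := subringM Fr Fb F2.
by rewrite /HQ8_gen /=; apply: (quat_entries Fr); rewrite //; apply: mx2_entries.
Qed.

Lemma omega3_realization :
  exists Ho, mx_subgroup (GL2 (@quadratic_field R 3)) Ho /\ isomorphic_to_HQ8 [set: C] 6 Ho.
Proof.
have Ff := generated_field_subfield [set sqrtm R 3]; have Fr := subfield_subring Ff.
have Fw := quadratic_field_omega3; have Fww := subringM Fr Fw Fw.
have F1 : quadratic_field 3 (1 : C) by case: Ff.
have F0 := subring0 Fr; have FN1 := subringN Fr F1; have FNw := subringN Fr Fw.
have F2 := subfieldV Ff (subring_nat 2 Fr).
apply: (subfield_realization (n := 6) Ff isT Q8_rel_omega3); try by apply: mx2_entries.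
have Fc := subringN Fr (subringM Fr Fww F2).
by rewrite /HQ8_gen /=; apply: (quat_entries Fr); rewrite //; apply: mx2_entries.
Qed.

(** zeta8 (1 + i) has square -2, so it is i sqrt(2) up to sign. *)
Lemma sqrt2_i_zeta8 : field_sqrt2_i (zeta8 R).
Proof.
have Ff := generated_field_subfield [set (Num.sqrt 2)%:C; 'i%C : C].
have gens := @sub_generated_field R [set (Num.sqrt 2)%:C; 'i%C : C].
have Fr := subfield_subring Ff.
have Fs : field_sqrt2_i ((Num.sqrt 2)%:C : C) by exact: gens _ (or_introl erefl).
have Fi : field_sqrt2_i ('i%C : C) by exact: gens _ (or_intror erefl).
have F1 : field_sqrt2_i (1 : C) by case: Ff.
have s2 : (Num.sqrt 2)%:C * (Num.sqrt 2)%:C = 2 :> C.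
  by rewrite -rmorphM -expr2 sqr_sqrtr ?ler0n // rmorph_nat.
have [y Fy yE] : exists2 y : C, field_sqrt2_i y & zeta8 R * (1 + 'i%C) = y.
  have : (zeta8 R * (1 + 'i%C)) * (zeta8 R * (1 + 'i%C)) =
      ((Num.sqrt 2)%:C * 'i%C) * ((Num.sqrt 2)%:C * 'i%C).
    rewrite [RHS]mulrACA s2; exact: (root8_sqr iC2 (zeta8_sqr R)).
  have Fsi := subringM Fr Fs Fi.
  case/sqr_eq_or => ->; [by exists ((Num.sqrt 2)%:C * 'i%C) |].
  by exists (- ((Num.sqrt 2)%:C * 'i%C)) => //; apply: subringN Fr Fsi.
have -> : zeta8 R = y * (1 - 'i%C) / 2.
  by rewrite -yE; apply: (root8_eq _ iC2 two0).
have Fy' := subringM Fr Fy (subringD Fr F1 (subringN Fr Fi)).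
exact: (subringM Fr Fy' (subfieldV Ff (subring_nat 2 Fr))).
Qed.

Lemma sqrt2_i_realizations j : j \in [:: 3; 7; 8]%N ->
  exists Ho, mx_subgroup (GL2 (@field_sqrt2_i R)) Ho /\ isomorphic_to_HQ8 [set: C] j Ho.
Proof.
move=> jE; have j19 : (1 <= j <= 9)%N by move: jE; rewrite !inE => /or3P[] /eqP ->.
have Ff := generated_field_subfield [set (Num.sqrt 2)%:C; 'i%C : C].
have gens := @sub_generated_field R [set (Num.sqrt 2)%:C; 'i%C : C].
have Fr := subfield_subring Ff.
have Fi : field_sqrt2_i ('i%C : C) by exact: gens _ (or_intror erefl).
have F1 : field_sqrt2_i (1 : C) by case: Ff.
have F0 := subring0 Fr; have FN1 := subringN Fr F1; have FNi := subringN Fr Fi.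
have F2 := subfieldV Ff (subring_nat 2 Fr).
have Fz := sqrt2_i_zeta8; have F1i := subringD Fr F1 Fi.
have Fc := subringM Fr F1i F2; have Fzc := subringM Fr (subringM Fr Fz F1i) F2.
have E1 : forall k l, field_sqrt2_i (std1 ('i%C : C) k l) by apply: mx2_entries.
have E2 : forall k l, field_sqrt2_i (std2 C k l) by apply: mx2_entries.
apply: (subfield_realization Ff j19 (Q8_rel_std iC2)) => //.
by move: jE; rewrite !inE => /or3P[] /eqP ->; rewrite /HQ8_gen /=; apply: (quat_entries Fr).
Qed.

End ExplicitRealizations.

(** * Units of the endomorphism ring *)

Section Traces.
Variable R : realType.
Local Notation C := R[i].
Local Notation iC2 := (sqr_iC R).
Local Notation two0 := (two_neq0C R).
Implicit Types (S : set C).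

Lemma int_mulC_eq1 (m n : int) : m%:~R * n%:~R = 1 :> C -> m = 1 \/ m = -1.
Proof.
rewrite -intrM => /eqP; rewrite -[1]/(1%:~R) eqr_int => /eqP mn.
have /eqP := congr1 absz mn; rewrite abszM muln_eq1 => /andP[/eqP m1 _].
lia.
Qed.

(** With t and n the trace and norm of x, t^2 = tr (x^2) + 2 n, and n^2 is the
    norm of x^2.  Knowing x^2 thus excludes x whenever the resulting value of
    t^2 is not a square. *)
Lemma trace_square S (x y y' : C) : integral_ring S -> S x -> x * x = y ->
  conjc y = y' -> exists t n : int, t%:~R ^+ 2 = y + y' + 2 * n%:~R :> C /\
    n%:~R * n%:~R = y * y' :> C.
Proof.
move=> [_ Sint] Sx xy yy'; have [[t tE] [n nE]] := Sint _ Sx.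
exists t, n; rewrite -tE -nE -yy' -xy conjcM.
by rewrite mulrACA expr2; split=> //; rewrite mulrDl !mulrDr [conjc x * x]mulrC; ring.
Qed.

Lemma units_norm S (d : C) : integral_ring S -> units S d -> d * conjc d = 1.
Proof.
move=> [_ Sint] [Sd [v [Sv dv]]].
have [_ [m mE]] := Sint _ Sd; have [_ [n nE]] := Sint _ Sv.
have mn : m%:~R * n%:~R = 1 :> C.
  by rewrite -mE -nE mulrACA -conjcM dv mul1r; apply: rmorph1.
have [m1 | m1] := int_mulC_eq1 mn; first by rewrite mE m1.
have /(congr1 (@complex.Re R)) := mE; rewrite m1; case: (d) => a b /=.
rewrite mulrN opprK => E.
have : 0 <= a * a + b * b by rewrite addr_ge0 // -expr2 sqr_ge0.
by rewrite E oppr_ge0 ler10.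
Qed.

(** A unit has norm 1, so it lies on the unit circle, and its integral trace is
    at most 2 in absolute value. *)
Lemma units_cases S (d : C) : integral_ring S -> units S d ->
  [\/ d = 1, d = -1, d * d = -1 | d * d = - d - 1] \/ d * d = d - 1.
Proof.
move=> Si Sd; have N1 := units_norm Si Sd.
have [[t tE] _] := Si.2 d Sd.1.
have dE : d * d = t%:~R * d - 1 by rewrite -tE -N1; ring.
have : t * t <= 4.
  have tRe : t%:~R = complex.Re d + complex.Re d :> R.
    have ratC : (t%:~R : R)%:C = t%:~R :> C by apply: rmorph_int.
    have /(congr1 (@complex.Re R)) := tE; rewrite -ratC /= => <-.
    by case: (d).
  have N : complex.Re d * complex.Re d + complex.Im d * complex.Im d = 1.
    have /(congr1 (@complex.Re R)) := N1.
    by case: (d) => a b /=; rewrite mulrN opprK.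
  rewrite -(ler_int R) intrM tRe.
  have : 0 <= complex.Im d * complex.Im d by rewrite -expr2 sqr_ge0.
  by move: N; move: (complex.Re d) (complex.Im d) => a b; nra.
move=> t4; have : t = 2 \/ t = -2 \/ t = 0 \/ t = -1 \/ t = 1 by nia.
case=> [tt | [tt | [tt | [tt | tt]]]]; rewrite tt in dE.
- left; apply: Or41; apply/eqP; rewrite -subr_eq0 -sqrf_eq0 expr2; apply/eqP.
  have -> : (d - 1) * (d - 1) = d * d - (2%:~R * d - 1) by ring.
  by rewrite dE subrr.
- left; apply: Or42; apply/eqP; rewrite -addr_eq0 -sqrf_eq0 expr2; apply/eqP.
  have -> : (d + 1) * (d + 1) = d * d - ((-2)%:~R * d - 1) by ring.
  by rewrite dE subrr.
- by left; apply: Or43; rewrite dE; ring.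
- by left; apply: Or44; rewrite dE; ring.
- by right; rewrite dE; ring.
Qed.

End Traces.

(** * Finite groups whose special part is the quaternion group *)

Section Classification.
Variable R : realType.
Local Notation C := R[i].
Local Notation M2 := 'M[R[i]]_2.
Local Notation iC2 := (sqr_iC R).
Local Notation two0 := (two_neq0C R).

Lemma Q8_axis_neq (k1 k2 a : M2) u : Q8_rel k1 k2 ->
  Q8_elt k1 k2 u * k1 = a * Q8_elt k1 k2 u -> [\/ a = k2, a = - k2 | a = k1 * k2] -> False.
Proof.
move=> rel /(Q8_axis iC2 two0 rel) ak aE.
have inj := Q8_elt_inj iC2 two0 rel.
have [w1 w1N w2 w2N w3] := Q8_elt_words k1 k2.
have neq t t' (x y : M2) : Q8_elt k1 k2 t = x -> Q8_elt k1 k2 t' = y -> t != t' -> x <> y.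
  by move=> <- <- /eqP tt' /inj.
case: aE ak => -> [].
- exact: (neq _ _ _ _ w2 w1).
- exact: (neq _ _ _ _ w2 w1N).
- exact: (neq _ _ _ _ w2N w1).
- exact: (neq _ _ _ _ w2N w1N).
- exact: (neq _ _ _ _ w3 w1).
- exact: (neq _ _ _ _ w3 w1N).
Qed.

Variables (S : set C) (H : set M2) (g1 g2 : M2).
Hypothesis Si : integral_ring S.
Hypothesis HG : mx_subgroup (GL2 S) H.
Hypothesis rel : Q8_rel g1 g2.
Hypothesis HQ : H `&` SL2 S = mx_generated [set g1; g2].
Local Notation elt := (Q8_elt g1 g2).

Lemma mxgrp_mul x y : H x -> H y -> H (x * y).
Proof. by case: HG => _ _ HM _; apply: HM. Qed.

Lemma mxgrp_exp x n : H x -> H (x ^+ n).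
Proof.
move=> Hx; elim: n => [|n IHn]; first by rewrite expr0; case: HG.
by rewrite exprS; apply: mxgrp_mul.
Qed.

Lemma mxgrp_inv x : H x -> H x^-1.
Proof. by case: HG => _ _ _; apply. Qed.

Lemma mxgrp_GL2 x : H x -> GL2 S x.
Proof. by case: HG => HS _ _ _; apply: HS. Qed.

Lemma mxgrp_unit x : H x -> x \is a GRing.unit.
Proof.
by move=> /mxgrp_GL2[_ [_ [v [_ xv]]]]; apply/GL2_full; split=> //; split=> //; exists v.
Qed.

Lemma mem_Q8_elt t : H (elt t) /\ SL2 S (elt t).
Proof.
have : (H `&` SL2 S) (elt t) by rewrite HQ (mx_generated_Q8 rel); exists t.
by case.
Qed.

Lemma det1_Q8_elt x : H x -> \det x = 1 -> exists t, x = elt t.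
Proof.
move=> Hx dx; have : (H `&` SL2 S) x by split=> //; split=> //; apply: mxgrp_GL2.
by rewrite HQ (mx_generated_Q8 rel) => -[t _ <-]; exists t.
Qed.

Lemma conj_Q8_elt x h : H x -> \det x = 1 -> H h -> exists t, h * x = elt t * h.
Proof.
move=> Hx dx Hh; have hu := mxgrp_unit Hh.
have Hc : H (h * x * h^-1).
  exact: (mxgrp_mul (mxgrp_mul Hh Hx) (mxgrp_inv Hh)).
have [t tE] : exists t, h * x * h^-1 = elt t.
  apply: det1_Q8_elt => //; rewrite -!mulmxE !det_mulmx dx mulr1 -det_mulmx mulmxE.
  by rewrite divrr // det1.
by exists t; rewrite -tE mulrVK.
Qed.

(** Every coset of Q in H has a representative of one of the three types. *)
Lemma coset_normal_form h : H h -> exists k1 k2 h',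
  [/\ Q8_rel k1 k2, range (Q8_elt k1 k2) = range elt, H h', \det h' = \det h &
   [\/ h' * k1 = k1 * h' /\ h' * k2 = k2 * h',
       h' * k1 = k2 * h' /\ h' * k2 = - k1 * h' |
       h' * k1 = k2 * h' /\ h' * k2 = k1 * k2 * h']].
Proof.
move=> Hh; have [d1 d2] := Q8_rel_det rel.
have [e1 _ e2 _ _] := Q8_elt_words g1 g2.
have Hg1 : H g1 by rewrite -e1; case: (mem_Q8_elt (false, true, false)).
have Hg2 : H g2 by rewrite -e2; case: (mem_Q8_elt (false, false, true)).
have [u1 E1] := conj_Q8_elt Hg1 d1 Hh; have [u2 E2] := conj_Q8_elt Hg2 d2 Hh.
have [k1 [k2 [t [relk rangek cases]]]] := Q8_normalizer iC2 two0 rel (mxgrp_unit Hh) E1 E2.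
exists k1, k2, (h * elt t); split; [exact: relk | exact: rangek | | | exact: cases].
  exact: (mxgrp_mul Hh (mem_Q8_elt t).1).
by rewrite -mulmxE det_mulmx (det_Q8_elt iC2 two0 rel) mulr1.
Qed.

Section NewPair.
Variables k1 k2 : M2.
Hypothesis relk : Q8_rel k1 k2.
Hypothesis rangek : range (Q8_elt k1 k2) = range elt.

Lemma mem_newpair t : H (Q8_elt k1 k2 t) /\ SL2 S (Q8_elt k1 k2 t).
Proof.
have : range elt (Q8_elt k1 k2 t) by rewrite -rangek; exists t.
by case=> u _ <-; apply: mem_Q8_elt.
Qed.

Lemma det1_newpair x : H x -> \det x = 1 -> exists t, x = Q8_elt k1 k2 t.
Proof.
move=> Hx dx; have [t tE] := det1_Q8_elt Hx dx.
have : range (Q8_elt k1 k2) x by rewrite rangek; exists t.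
by case=> u _ <-; exists u.
Qed.

Lemma mxgrp_opp x : H x -> H (- x).
Proof.
move=> Hx; rewrite -mulN1r -(Q8_elt_minus k1 k2).
exact: (mxgrp_mul (mem_newpair (true, false, false)).1 Hx).
Qed.

Lemma det1_axis x a : H x -> \det x = 1 -> x * k1 = a * x ->
  [\/ a = k2, a = - k2 | a = k1 * k2] -> False.
Proof.
by move=> Hx dx; have [t ->] := det1_newpair Hx dx; apply: Q8_axis_neq.
Qed.

(** Once its determinants are powers of that of the third generator, H is
    generated by Q and this generator: x times a suitable power of it has
    determinant 1, hence lies in Q. *)
Lemma isomorphic_to_HQ8_gen n : (1 <= n <= 9)%N -> H (HQ8_gen n k1 k2) ->
  (forall x, H x -> exists m : nat, \det x = HQ8_gendet R n ^+ m) ->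
  isomorphic_to_HQ8 S n H.
Proof.
move=> n19 Hh dets; have [Sr _] := Si.
have [e1 _ e2 _ _] := Q8_elt_words k1 k2.
have [H1 S1] : H k1 /\ SL2 S k1 by rewrite -e1; apply: mem_newpair.
have [H2 S2] : H k2 /\ SL2 S k2 by rewrite -e2; apply: mem_newpair.
have hu := HQ8_gen_unit relk n19.
have gens : [set k1; k2; HQ8_gen n k1 k2] `<=` GL2 [set: C].
  by move=> x [/(Q8_rel_GL2 relk) // | ->]; apply/GL2_full.
have HE : H = mx_generated [set k1; k2; HQ8_gen n k1 k2].
  apply/seteqP; split; last first.
    apply: mx_generated_min; last by move=> x [[] | ] ->.
    case: HG => HS H1' HM HV; split; [ | exact: H1' | exact: HM | exact: HV].
    by move=> x Hx; apply/GL2_full; apply: mxgrp_unit Hx.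
  move=> x Hx; have [m dx] := dets x Hx.
  have [_ _ GM GV] := mx_generated_subgroup gens.
  have hmu : HQ8_gen n k1 k2 ^+ m \is a GRing.unit by rewrite unitrX.
  have Hm := mxgrp_exp m Hh.
  have [t tE] : exists t, (HQ8_gen n k1 k2 ^+ m)^-1 * x = Q8_elt k1 k2 t.
    apply: det1_newpair; first exact: (mxgrp_mul (mxgrp_inv Hm) Hx).
    rewrite -mulmxE det_mulmx dx -(HQ8_gen_det relk n19) -det_mxX.
    by rewrite -det_mulmx mulmxE (mulVr hmu) det1.
  rewrite -[x](mulVKr hmu) tE (HQ8_gen_generated relk n19).
  have hdet := HQ8_gendet_primitive R n19; rewrite -(HQ8_gen_det relk n19) in hdet.
  have hnorm := HQ8_gen_normalizes relk n19.
  have hpow : exists t, HQ8_gen n k1 k2 ^+ HQ8_index n = Q8_elt k1 k2 t.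
    by exists (HQ8_pow n); apply: HQ8_gen_pow.
  apply: (ext_elt_mul relk hnorm hdet hpow).
    exact: (ext_elt_exp relk hdet hpow).
  exact: (ext_elt_Q8 relk hdet hpow).
have HK : is_HQ8 S n H.
  by rewrite HE; exact: (HQ8_gen_is_HQ8 relk n19 Sr S1 S2 (mxgrp_GL2 Hh)).
by split; [exists H | move=> K; apply: is_HQ8_unique n19 HK].
Qed.

(** Action and determinant determine the third generator up to sign, and -1 is
    in H. *)
Lemma mem_HQ8_gen n h : (1 <= n <= 9)%N -> H h -> \det h = HQ8_gendet R n ->
  h * k1 = (HQ8_act n k1 k2).1 * h -> h * k2 = (HQ8_act n k1 k2).2 * h ->
  H (HQ8_gen n k1 k2).
Proof.
move=> n19 Hh hd h1 h2; have [u1 u2] := HQ8_gen_act relk n19.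
have uu := HQ8_gen_unit relk n19.
have hdu : \det h = \det (HQ8_gen n k1 k2) by rewrite hd HQ8_gen_det.
have [<- // | hE] := same_action_sign relk h1 h2 u1 u2 uu hdu.
by rewrite -[HQ8_gen _ _ _]opprK -hE; apply: mxgrp_opp.
Qed.

Lemma centralizing_scalar h : H h -> h * k1 = k1 * h -> h * k2 = k2 * h ->
  exists c : C, [/\ h = c%:M, S c & c * c = \det h].
Proof.
move=> Hh h1 h2; have [c hE] := quat_centre iC2 two0 relk h1 h2.
exists c; split; [exact: hE | | by rewrite hE det_scalar expr2].
by have [Sh _] := mxgrp_GL2 Hh; have := Sh 0 0; rewrite hE mxE mulr1n.
Qed.

End NewPair.
End Classification.

Lemma order6_trace (F : fieldType) (d e : F) : d * e = 1 -> d * d = d - 1 -> d + e = 1.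
Proof.
move=> de dd; have d0 : d != 0.
  by apply: contra_eq_neq de => ->; rewrite mul0r eq_sym oner_eq0.
by apply: (mulfI d0); rewrite mulrDr de dd; ring.
Qed.

Lemma order6_cube (F : fieldType) (d : F) : d * d = d - 1 -> d ^+ 3 = -1.
Proof. by move=> dd; rewrite !exprS expr0 mulr1; ring: dd. Qed.

Lemma order6_complement (F : fieldType) (d e : F) : d + e = 1 -> d * e = 1 ->
  1 - d + (1 - e) = 1 /\ (1 - d) * (1 - e) = 1.
Proof.
move=> s p; have -> : e = 1 - d by rewrite -s; ring.
have dd : d * d = d - 1 by rewrite -p -[X in X - _]mulr1 -s; ring.
by split; ring: dd.
Qed.

Section Cases.
Variable R : realType.
Local Notation C := R[i].
Local Notation M2 := 'M[R[i]]_2.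
Local Notation iC2 := (sqr_iC R).
Local Notation two0 := (two_neq0C R).
Local Notation w2 := (omega3_sqr R).

Lemma order_gaussian (S : set C) : integral_ring S -> S 'i%C -> S = @gaussian_integers R.
Proof. by move=> Si Sii; apply: (adjoin_eq Si Sii); apply: gauss_adjoin. Qed.

Lemma order_sqrtm2 (S : set C) : integral_ring S -> S (sqrtm R 2) ->
  S = @quadratic_integers R 2.
Proof.
move=> Si Sb; rewrite (adjoin_eq Si Sb (@sqrtm2_adjoin R)).
have Qi := quadratic_integers_integral_ring R (isT : 0 < 2)%N.
by rewrite (adjoin_eq Qi (quadratic_integers_sqrtm2 R) (@sqrtm2_adjoin R)).
Qed.

Lemma order_omega3 (S : set C) : integral_ring S -> S (omega3 R) ->
  S = @quadratic_integers R 3.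
Proof.
move=> Si Sw; rewrite (adjoin_eq Si Sw (@omega3_adjoin R)).
have Qi := quadratic_integers_integral_ring R (isT : 0 < 3)%N.
by rewrite (adjoin_eq Qi (quadratic_integers_omega3 R) (@omega3_adjoin R)).
Qed.

Lemma int_pow_nat (d : C) q (m : int) : (0 < q)%N -> d ^+ q = 1 ->
  exists n : nat, d ^ m = d ^+ n.
Proof.
move=> q_gt0 dq; case: m => n; first by exists n.
have d0 : d != 0.
  by apply: contra_eq_neq dq => ->; rewrite expr0n gtn_eqF // eq_sym oner_eq0.
exists (q.-1 * n.+1)%N; rewrite -[LHS]/((d ^+ n.+1)^-1); apply: (mulfI (expf_neq0 n.+1 d0)).
by rewrite divff ?expf_neq0 // -exprD -mulSn prednK // exprM dq expr1n.
Qed.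

(** The action of a cycling element has order 3, so neither its square nor its
    fourth power fixes the first axis. *)
Lemma cycle_exp (h k1 k2 : M2) : Q8_rel k1 k2 ->
  h * k1 = k2 * h -> h * k2 = k1 * k2 * h ->
  h ^+ 2 * k1 = k1 * k2 * h ^+ 2 /\ h ^+ 4 * k1 = k2 * h ^+ 4.
Proof.
move=> [k11 k22 k21] h1 h2.
have E1 : h ^+ 2 * k1 = k1 * k2 * h ^+ 2 by rewrite expr2 -mulrA h1 mulrA h2 -!mulrA.
have k212 : k2 * (k1 * k2) = k1 by rewrite mulrA k21 mulNr -mulrA k22 mulrN1 opprK.
have E2 : h ^+ 2 * k2 = k1 * h ^+ 2.
  by rewrite expr2 -mulrA h2 !mulrA h1 -(mulrA k2) h2 !mulrA -(mulrA k2) k212.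
split=> //; rewrite -[4%N]/(2 + 2)%N exprD -mulrA E1 !mulrA E1 -(mulrA (k1 * k2)) E2.
by rewrite -!mulrA [k2 * (k1 * _)]mulrA k21 mulNr -mulrA mulrN mulrA k11 mulN1r opprK.
Qed.

Lemma rot_exp (h k1 k2 : M2) : h * k1 = k2 * h -> h * k2 = - k1 * h ->
  h ^+ 3 * k1 = - k2 * h ^+ 3.
Proof.
move=> h1 h2; rewrite !exprS expr0 mulr1 -!mulrA h1 (mulrA h k2) h2.
by rewrite !mulrA mulrN h1 !mulNr.
Qed.

Section Group.
Variables (S : set C) (H : set M2) (g1 g2 : M2).
Hypothesis Si : integral_ring S.
Hypothesis HG : mx_subgroup (GL2 S) H.
Hypothesis rel : Q8_rel g1 g2.
Hypothesis HQ : H `&` SL2 S = mx_generated [set g1; g2].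
Local Notation elt := (Q8_elt g1 g2).

Lemma sqr_mem (x y : C) : S x -> x * x = y * y -> S y.
Proof.
move=> Sx /esym/sqr_eq_or[-> // | ->]; exact: (subringN Si.1 Sx).
Qed.

(** A rotating element of determinant -1 is, up to sign, the third generator of
    index 3, whose trace zeta8 (1 + i) has square -2. *)
Lemma det_minus_one h : H h -> \det h = -1 -> exists k1 k2 : M2,
  [/\ Q8_rel k1 k2, range (Q8_elt k1 k2) = range elt &
      (S 'i%C /\ H (HQ8_gen 1 k1 k2)) \/ (S (sqrtm R 2) /\ H (HQ8_gen 3 k1 k2))].
Proof.
move=> Hh dh; have [k1 [k2 [h' [relk rangek Hh' dh' cases]]]] := coset_normal_form HG rel HQ Hh.
rewrite dh in dh'; exists k1, k2; split; [exact: relk | exact: rangek | ].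
case: cases => -[h1 h2].
- left; have [c [_ Sc cc]] := centralizing_scalar HG relk Hh' h1 h2.
  split; first by apply: (sqr_mem Sc); rewrite cc dh' iC2.
  by apply: (mem_HQ8_gen HG rel HQ relk rangek (n := 1)) Hh' dh' _ _.
- right; have Hgen : H (HQ8_gen 3 k1 k2).
    by apply: (mem_HQ8_gen HG rel HQ relk rangek (n := 3)) Hh' dh' _ _.
  split; last exact: Hgen.
  have [Sgen _] := mxgrp_GL2 HG Hgen.
  have St : S (\tr (HQ8_gen 3 k1 k2)) by rewrite trace_mx2; apply: (subringD Si.1).
  apply: (sqr_mem St); rewrite /HQ8_gen /= (tr_quat iC2 two0 relk) sqrtm_sqr.
  have -> : 2 * (zeta8 R * (1 + 'i%C) / 2) = zeta8 R * (1 + 'i%C).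
    by rewrite mulrCA (divff two0) mulr1.
  by rewrite (root8_sqr iC2 (zeta8_sqr R)) iC2 mulrN1.
- have [E _] := cycle_exp relk h1 h2.
  have [] := det1_axis HG rel HQ relk rangek (mxgrp_exp HG 2 Hh') _ E _.
    by rewrite det_mxX dh' sqrrN expr1n.
  exact: Or33.
Qed.

(** The trace t of c would satisfy t^2 = 2 n with n = 1 or -1. *)
Lemma no_sqrt_i (c : C) : S c -> c * c = 'i%C -> False.
Proof.
move=> Sc cc; have [t [n []]] := trace_square Si Sc cc (conjc_i R).
rewrite subrr add0r mulrN iC2 opprK => tE nn.
have /int_cast_inj tE' : (t * t)%:~R = (2 * n)%:~R :> C by rewrite !intrM -tE expr2.
have [z zE] := sqr_even tE'.
by case: (int_mulC_eq1 nn) => nE; move: tE'; rewrite nE zE; lia.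
Qed.

Lemma det_i_mem_gen9 h : H h -> \det h = 'i%C -> exists k1 k2 : M2,
  [/\ Q8_rel k1 k2, range (Q8_elt k1 k2) = range elt & H (HQ8_gen 9 k1 k2)].
Proof.
move=> Hh dh; have [k1 [k2 [h' [relk rangek Hh' dh' cases]]]] := coset_normal_form HG rel HQ Hh.
rewrite dh in dh'; exists k1, k2; split; [exact: relk | exact: rangek | ].
case: cases => -[h1 h2].
- have [c [_ Sc cc]] := centralizing_scalar HG relk Hh' h1 h2.
  by case: (no_sqrt_i Sc); rewrite cc dh'.
- by apply: (mem_HQ8_gen HG rel HQ relk rangek (n := 9)) Hh' dh' _ _.
- have [_ E] := cycle_exp relk h1 h2.
  have [] := det1_axis HG rel HQ relk rangek (mxgrp_exp HG 4 Hh') _ E _.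
    by rewrite det_mxX dh' -[4%N]/(2 * 2)%N exprM !expr2 iC2 mulrNN mulr1.
  exact: Or31.
Qed.

Lemma det_omega3_mem_gen h : H h -> \det h = omega3 R -> exists k1 k2 : M2,
  [/\ Q8_rel k1 k2, range (Q8_elt k1 k2) = range elt &
      H (HQ8_gen 5 k1 k2) \/ H (HQ8_gen 6 k1 k2)].
Proof.
move=> Hh dh; have [k1 [k2 [h' [relk rangek Hh' dh' cases]]]] := coset_normal_form HG rel HQ Hh.
rewrite dh in dh'; exists k1, k2; split; [exact: relk | exact: rangek | ].
case: cases => -[h1 h2].
- left; have [c [hE _ cc]] := centralizing_scalar HG relk Hh' h1 h2.
  rewrite /HQ8_gen /= quat_scalar -dh' -cc scalar_mxM mulmxE -hE.
  exact: (mxgrp_mul HG Hh' Hh').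
- have E := rot_exp h1 h2.
  have [] := det1_axis HG rel HQ relk rangek (mxgrp_exp HG 3 Hh') _ E _.
    by rewrite det_mxX dh' !exprS expr0 mulr1 mulrA (omega_cube w2).
  exact: Or32.
- right; by apply: (mem_HQ8_gen HG rel HQ relk rangek (n := 6)) Hh' dh' _ _.
Qed.

(** The cube of h has determinant -1, so S contains i or sqrt(-2).  The product
    with the sixth root of unity det h has trace t with t^2 = 1 + 2 n, n^2 = 1
    in the first case and t^2 = 2 + 2 n, n^2 = 4 in the second: none of the
    values 3, -1, 6, -2 is a square. *)
Lemma no_det_order6 h : H h -> \det h * \det h = \det h - 1 -> False.
Proof.
move=> Hh; have [_ du] := mxgrp_GL2 HG Hh; have N1 := units_norm Si du.
have Sd := du.1; have d3 := det_mxX h 3; have H3 := mxgrp_exp HG 3 Hh.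
move: (\det h) du N1 Sd d3 => d _ N1 Sd d3 dd.
have tr1 : d + conjc d = 1 by apply: (order6_trace N1 dd).
have dJ : conjc (1 - d) = 1 - conjc d.
  by rewrite -[in RHS](rmorph1 (@conjc R)); apply: (rmorphB (@conjc R)).
have [sum_y prod_y] := order6_complement tr1 N1.
rewrite (order6_cube dd) in d3.
have [k1 [k2 [_ _ [[Sv _] | [Sv _]]]]] := det_minus_one H3 d3.
- have xx : 'i%C * d * ('i%C * d) = 1 - d by rewrite mulrACA iC2 mulN1r dd opprB.
  have [t [n [tE nE]]] := trace_square Si (subringM Si.1 Sv Sd) xx dJ.
  rewrite sum_y in tE; rewrite prod_y in nE.
  have /int_cast_inj tt : (t * t)%:~R = (1 + 2 * n)%:~R :> C.
    by rewrite intrD !intrM -expr2 tE.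
  have t_ge0 : 0 <= t * t by rewrite -expr2 sqr_ge0.
  have [n1 | n1] := int_mulC_eq1 nE; rewrite n1 in tt; last by lia.
  have [z zE] := sqr_dvd3 (y := 1) tt.
  by rewrite zE in tt; lia.
- have xx : sqrtm R 2 * d * (sqrtm R 2 * d) = 2 * (1 - d).
    by rewrite mulrACA sqrtm_sqr dd mulNr -mulrN opprB.
  have dJ2 : conjc (2 * (1 - d)) = 2 * (1 - conjc d).
    by rewrite conjcM dJ; congr (_ * _); apply: (conjc_int _ 2).
  have [t [n [tE nE]]] := trace_square Si (subringM Si.1 Sv Sd) xx dJ2.
  rewrite -mulrDr sum_y mulr1 in tE; rewrite mulrACA prod_y mulr1 in nE.
  have /int_cast_inj tt : (t * t)%:~R = (2 * (1 + n))%:~R :> C.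
    by rewrite mulrDr mulr1 intrD !intrM -expr2 tE.
  have /int_cast_inj nn : (n * n)%:~R = (4%:Z)%:~R :> C.
    by rewrite intrM nE; ring.
  have [z zE] := sqr_even tt; rewrite zE in tt.
  have n2 : n = 2 \/ n = -2 by nia.
  by case: n2 => n2; rewrite n2 in tt; nia.
Qed.

End Group.
End Cases.

Lemma omega_factor (F : fieldType) (d w : F) : w * w = - w - 1 -> d * d = - d - 1 ->
  (d - w) * (d - w * w) = 0.
Proof. by move=> w2 d2; ring: w2 d2. Qed.

Lemma HQ8_classification (R : realType) (S : set R[i]) (H : set 'M[R[i]]_2)
    (g1 g2 ho : 'M[R[i]]_2) (s : nat) :
  is_elliptic_endomorphism_ring S -> mx_subgroup (GL2 S) H ->
  H `&` SL2 S = mx_generated [set g1; g2] -> Q8_generators g1 g2 -> H ho ->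
  [set \det g | g in H] = [set \det ho ^ k | k in [set: int]] ->
  [set \det g | g in H] #= `I_s -> (1 < s)%N ->
  exists i : nat, (1 <= i <= 9)%N /\ HQ8_ring i S /\ isomorphic_to_HQ8 S i H.
Proof.
move=> /elliptic_integral_ring Si HG HQ /Q8_generators_rel rel Ho detH card_det s_gt1.
have [_ du] := mxgrp_GL2 HG Ho.
have iC2 := sqr_iC R; have w2 := omega3_sqr R.
have ww : omega3 R * omega3 R * (omega3 R * omega3 R) = omega3 R.
  by rewrite mulrA (omega_cube w2) mul1r.
have d_neq1 : \det ho != 1.
  apply/eqP => d1; have : [set \det ho ^ k | k in [set: int]] = [set 1].
    apply/seteqP; split=> [_ [k _ <-] | _ ->]; first by rewrite d1 exp1rz.
    by exists 0.
  rewrite -detH => E; rewrite E in card_det.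
  have /card_eq_II s1 : `I_1 #= `I_s.
    by apply: card_eq_trans card_det; rewrite card_eq_sym; apply: card_set1.
  by rewrite -s1 in s_gt1.
have dets q : (0 < q)%N -> \det ho ^+ q = 1 ->
    forall x, H x -> exists m : nat, \det x = \det ho ^+ m.
  move=> q_gt0 dq x Hx; have : [set \det g | g in H] (\det x) by exists x.
  by rewrite detH => -[k _ <-]; apply: int_pow_nat dq.
have [[d1 | d1 | dd | dd] | dd] := units_cases Si du.
- by rewrite d1 eqxx in d_neq1.
- have dx := dets 2%N isT; rewrite d1 sqrrN expr1n in dx.
  have [k1 [k2 [relk rangek [[Sv Hv] | [Sv Hv]]]]] := det_minus_one Si HG rel HQ Ho d1.
    exists 1%N; split; [by [] | split]; first exact: (order_gaussian Si Sv).
    exact: (isomorphic_to_HQ8_gen Si HG rel HQ relk rangek (n := 1) isT Hv (dx erefl)).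
  exists 3%N; split; [by [] | split]; first exact: (order_sqrtm2 Si Sv).
  exact: (isomorphic_to_HQ8_gen Si HG rel HQ relk rangek (n := 3) isT Hv (dx erefl)).
- have Sii : S 'i%C by apply: (sqr_mem Si du.1); rewrite dd iC2.
  have d4 : \det ho ^+ 4 = 1 by rewrite -[4%N]/(2 * 2)%N exprM !expr2 dd mulrNN mulr1.
  have [h [Hh dh [a da]]] : exists h, [/\ H h, \det h = 'i%C &
      exists a, \det ho = 'i%C ^+ a].
    have : \det ho * \det ho = 'i%C * 'i%C by rewrite dd iC2.
    case/sqr_eq_or => d1; first by exists ho; split; [exact: Ho | exact: d1 | exists 1%N].
    (* det ho = - i, whose cube is i *)
    exists (ho ^+ 3); split; [exact: (mxgrp_exp HG 3 Ho) | | exists 3%N].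
      by rewrite det_mxX !exprS expr0 mulr1 dd d1 mulrNN mulr1.
    by rewrite !exprS expr0 mulr1 iC2 mulrN1.
  have [k1 [k2 [relk rangek Hv]]] := det_i_mem_gen9 Si HG rel HQ Hh dh.
  exists 9%N; split; [by [] | split]; first exact: (order_gaussian Si Sii).
  apply: (isomorphic_to_HQ8_gen Si HG rel HQ relk rangek (n := 9) isT Hv) => x Hx.
  have [m ->] := dets 4%N isT d4 x Hx.
  by exists (a * m)%N; rewrite da exprM.
- have d3 : \det ho ^+ 3 = 1 by rewrite !exprS expr0 mulr1 mulrA (omega_cube dd).
  have [h [Hh dh [a da]]] : exists h, [/\ H h, \det h = omega3 R &
      exists a, \det ho = omega3 R ^+ a].
    have /eqP := omega_factor w2 dd.
    rewrite mulf_eq0 !subr_eq0 => /orP[] /eqP d1.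
      by exists ho; split; [exact: Ho | exact: d1 | exists 1%N].
    exists (ho ^+ 2); split; [exact: (mxgrp_exp HG 2 Ho) | | by exists 2%N].
    by rewrite det_mxX expr2 d1 ww.
  have Sw : S (omega3 R) by rewrite -dh; have [_ []] := mxgrp_GL2 HG Hh.
  have [k1 [k2 [relk rangek Hv]]] := det_omega3_mem_gen HG rel HQ Hh dh.
  have SE := order_omega3 Si Sw.
  case: Hv => Hv; [exists 5%N | exists 6%N]; (split; [by [] | split; [exact: SE |]]).
    apply: (isomorphic_to_HQ8_gen Si HG rel HQ relk rangek (n := 5) isT Hv) => x Hx.
    have [m ->] := dets 3%N isT d3 x Hx.
    (* the third generator of index 5 has determinant omega3^2 *)
    by exists (2 * (a * m))%N; rewrite exprM /= expr2 ww da exprM.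
  apply: (isomorphic_to_HQ8_gen Si HG rel HQ relk rangek (n := 6) isT Hv) => x Hx.
  have [m ->] := dets 3%N isT d3 x Hx.
  by exists (a * m)%N; rewrite da exprM.
- by case: (no_det_order6 Si HG rel HQ Ho dd).
Qed.

Theorem proposition38 (R : realType) :
  (forall (S : set R[i]) (H : set 'M[R[i]]_2) (g1 g2 ho : 'M[R[i]]_2)
     (r s : nat) (l1 l2 : R[i]),
     is_elliptic_endomorphism_ring S ->
     mx_subgroup (GL2 S) H -> finite_set H ->
     H `&` SL2 S = mx_generated [set g1; g2] -> Q8_generators g1 g2 ->
     H ho -> r.-primitive_root ho ->
     [set \det g | g in H] = [set \det ho ^ k | k in [set: int]] ->
     [set \det g | g in H] #= `I_s -> (1 < s)%N ->
     eigenvalues ho l1 l2 ->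
     exists i : nat, (1 <= i <= 9)%N /\
       HQ8_ring i S /\ isomorphic_to_HQ8 S i H) /\
  (forall i : nat, i \in [:: 1; 2; 9]%N ->
     exists K, is_HQ8 (@gaussian_integers R) i K) /\
  (exists K, is_HQ8 (@quadratic_integers R 3) 5 K) /\
  (exists Ho, mx_subgroup (GL2 (quadratic_field 2)) Ho /\
     isomorphic_to_HQ8 [set: R[i]] 4 Ho) /\
  (exists Ho, mx_subgroup (GL2 (quadratic_field 3)) Ho /\
     isomorphic_to_HQ8 [set: R[i]] 6 Ho) /\
  (forall j : nat, j \in [:: 3; 7; 8]%N ->
     exists Ho, mx_subgroup (GL2 (@field_sqrt2_i R)) Ho /\
       isomorphic_to_HQ8 [set: R[i]] j Ho).
Proof.
split; last split; last split; last split; last split.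
- move=> S H g1 g2 ho r s l1 l2 ell HG _ HQ gens Ho _ detH card_det s_gt1 _.
  exact: (HQ8_classification ell HG HQ gens Ho detH card_det s_gt1).
- exact: gaussian_realizations.
- exact: quadratic_integers3_realization.
- exact: sqrtm2_realization.
- exact: omega3_realization.
- exact: sqrt2_i_realizations.
Qed.
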